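(* Let $M>0$ and let $\rho_1,\sigma_1\in H^2(-1,0)$, $q_1\in C([-1,0])$, $\rho_2,\sigma_2\in H^2(0,1)$, $q_2\in C([0,1])$ be real-valued and uniformly positive (each bounded below by a positive constant). Let $0<\lambda_1<\lambda_2<\cdots$ be the eigenvalues of the spectral problem $$\begin{cases}-(\sigma_1(x)u')'+q_1(x)u=\lambda\rho_1(x)u,& x\in(-1,0),\\ -(\sigma_2(x)v')'+q_2(x)v=\lambda\rho_2(x)v,& x\in(0,1),\\ u(-1)=v(1)=0,\quad u(0)=v(0),\\ \sigma_1(0)u'(0)-\sigma_2(0)v'(0)=\lambda Mu(0).\end{cases}$$ Then there is a constant $\delta_1>0$ such that $$\lambda_{n+1}-\lambda_n\ge\delta_1\qquad\text{for all } n\ge1.$$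
   Context: An eigenvalue is a value $\lambda$ for which the problem has a nonzero solution $(u,v)$. The eigenvalues of this problem are simple and positive and form an increasing sequence $(\lambda_n)_{n\ge1}$ tending to $+\infty$. *)

(* Defs.v *)
From HB Require Import structures.
From mathcomp Require Import all_boot all_order all_algebra.
From mathcomp Require Import all_classical all_reals all_analysis.
Set Implicit Arguments.
Unset Strict Implicit.
Unset Printing Implicit Defensive.
Import Order.TTheory GRing.Theory Num.Theory.
Import numFieldNormedType.Exports.
Local Open Scope classical_set_scope.
Local Open Scope ring_scope.

(** The Sobolev space H^2(a, b). *)

Definition square_integrable {R : realType} (a b : R) (f : R -> R) : Prop :=
  measurable_fun `]a, b[ f /\
  (@lebesgue_measure R).-integrable `]a, b[ (fun x => (f x ^+ 2)%:E).

(* phi belongs to C^1_c(]a, b[) (extended by 0 to the whole line) *)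
Definition test_function {R : realType} (a b : R) (phi : R -> R) : Prop :=
  [/\ forall x, derivable phi x 1,
      continuous (derive1 phi) &
      exists c d : R, [/\ a < c, d < b &
        forall x, x \notin `[c, d] -> phi x = 0]].

(* Weak derivatives are tested against C^1_c, as in Brezis, Functional
   Analysis, Sobolev Spaces and PDE, section 8.2. *)
Definition weak_derivative {R : realType} (a b : R) (f g : R -> R) : Prop :=
  forall phi : R -> R, test_function a b phi ->
    (\int[@lebesgue_measure R]_(x in `]a, b[) (f x * derive1 phi x))%R =
    - (\int[@lebesgue_measure R]_(x in `]a, b[) (g x * phi x))%R.

(* Elements of H^2(a, b) are classes of functions modulo null sets; a class has
   exactly one representative on [a, b] that is continuous there, and point
   values such as f a, f b, as well as pointwise bounds, refer to it.  Hence
   the continuity clause.  Values of f outside [a, b] are irrelevant. *)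
Definition H2 {R : realType} (a b : R) (f : R -> R) : Prop :=
  {within `[a, b], continuous f} /\
  exists f1 f2 : R -> R,
    [/\ square_integrable a b f, square_integrable a b f1,
        square_integrable a b f2, weak_derivative a b f f1 &
        weak_derivative a b f1 f2].

Definition uniformly_positive {R : realType} (a b : R) (f : R -> R) : Prop :=
  exists2 c : R, 0 < c & forall x, x \in `[a, b] -> c <= f x.

(** The spectral problem. *)

(* u is C^1 on [a, b] with derivative u'.  Since u' is continuous up to the
   endpoints, u' a and u' b are the one-sided derivatives of u; they would not
   be given by derive1 u, which looks at u on both sides of the point. *)
Definition C1_on {R : realType} (a b : R) (u u' : R -> R) : Prop :=
  [/\ {within `[a, b], continuous u}, {within `[a, b], continuous u'} &
      forall x, x \in `]a, b[ -> is_derive x 1 u (u' x)].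

Definition sturm_liouville {R : realType} (a b : R) (sigma q rho : R -> R)
    (lam : R) (u u' : R -> R) : Prop :=
  forall x, x \in `]a, b[ ->
    derivable (fun y => sigma y * u' y) x 1 /\
    - derive1 (fun y => sigma y * u' y) x + q x * u x = lam * rho x * u x.

Definition is_solution {R : realType} (M : R)
    (rho1 sigma1 q1 rho2 sigma2 q2 : R -> R) (lam : R)
    (u u' v v' : R -> R) : Prop :=
  [/\ C1_on (-1) 0 u u' /\ C1_on 0 1 v v',
      sturm_liouville (-1) 0 sigma1 q1 rho1 lam u u',
      sturm_liouville 0 1 sigma2 q2 rho2 lam v v',
      [/\ u (-1) = 0, v 1 = 0 & u 0 = v 0] &
      sigma1 0 * u' 0 - sigma2 0 * v' 0 = lam * M * u 0].

Definition is_eigenvalue {R : realType} (M : R)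
    (rho1 sigma1 q1 rho2 sigma2 q2 : R -> R) (lam : R) : Prop :=
  exists u u' v v' : R -> R,
    is_solution M rho1 sigma1 q1 rho2 sigma2 q2 lam u u' v v' /\
    ((exists2 x, x \in `[-1, 0] & u x != 0) \/
     (exists2 x, x \in `[0, 1] & v x != 0)).

(* Main.v *)
Require Import Defs.
From HB Require Import structures.
From mathcomp Require Import all_boot all_order all_algebra.
From mathcomp Require Import all_classical all_reals all_analysis.
From mathcomp Require Import measurable_realfun ring lra.
Import Order.TTheory GRing.Theory Num.Theory.
Import numFieldNormedType.Exports.
Local Open Scope classical_set_scope.
Local Open Scope ring_scope.
Set Implicit Arguments.
Unset Strict Implicit.
Unset Printing Implicit Defensive.

(** Write [p = sigma u'] for the flux of a mode.  On one half of the interval,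
    [E = lam rho sigma u^2 + p^2] satisfies [|E'| <= k E] with [k] independent
    of [lam >= lam0 > 0]: the large terms of [E'] cancel, except for
    [lam (rho sigma)' u^2].  Hence (Gronwall) [E] is comparable, uniformly in
    [lam], to the square of the flux at the Dirichlet endpoint, and the same
    estimate applied to a combination of two modes [u], [U], with eigenvalues
    [lam] and [lam + delta], shows that such a combination is of relative size
    [delta] as soon as its flux at the Dirichlet endpoint is
    ([energy_comparison], [energy_difference]).

    Let [(al, be)] and [(A, B)] be the endpoint fluxes of the two modes,
    normalised to unit vectors of the plane.  On the left half [al U - A u] is
    small, on the right half [be V - B v] is small, and the two conditions at
    the interface turn this into [|al B - be A| <= C delta]
    ([slopes_aligned]).  So up to sign the two modes are close to each other
    on both halves when [delta] is small.

    On the other hand modes for distinct eigenvalues are orthogonal: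
    [int rho1 u U + int rho2 v V + M u(0) U(0) = 0].  Two normalised modes
    cannot be both close and orthogonal, whence a lower bound for [delta].
    Integrals are avoided by following the Wronskian [p U - u P], whose
    derivative is [delta rho u U], from the Dirichlet endpoints to the interface
    ([lagrange_growth], [aligned_modes_gap]).  The bound from below of
    [int rho1 u^2 + int rho2 v^2 + M u(0)^2] uniformly in [lam] comes from the
    energy identity [lam (int rho u^2 + M u(0)^2) = int (p^2 / sigma + q u^2)].

    The argument differentiates [rho sigma], so the coefficients must be
    differentiable with bounded derivative.  For a function [f] of class H^2
    this is obtained by testing the weak derivatives against smoothed hat
    functions: the difference of two successive difference quotients of [f] is
    then the integral of [f''] against a hat, which is small on short intervals
    ([H2_slope_gap], [H2_bounded_derivative]). *)

(** * Differential inequalities *)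

Section Calculus.
Context {R : realType}.
Implicit Types (f g df dg : R -> R) (A : set R).

Lemma within_continuousM A f g :
  {within A, continuous f} -> {within A, continuous g} ->
  {within A, continuous (fun x => f x * g x)}.
Proof.
by move=> cf cg x; exact: (@continuousM R (subspace A) f g x (cf x) (cg x)).
Qed.

Lemma is_derive_add f g x (df dg : R) : is_derive x (1 : R) f df ->
  is_derive x (1 : R) g dg -> is_derive x 1 (fun t => f t + g t) (df + dg).
Proof. by move=> hf hg; exact: is_deriveD. Qed.

Lemma is_derive_mul f g x (df dg : R) : is_derive x (1 : R) f df ->
  is_derive x (1 : R) g dg ->
  is_derive x 1 (fun t => f t * g t) (f x * dg + g x * df).
Proof. by move=> hf hg; exact: is_deriveM. Qed.

Lemma is_derive_scale f x (k df : R) : is_derive x (1 : R) f df ->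
  is_derive x 1 (fun t => k * f t) (k * df).
Proof. by move=> hf; exact: is_deriveZ. Qed.

Lemma within_continuous_scale A f (k : R) : {within A, continuous f} ->
  {within A, continuous (fun x => k * f x)}.
Proof.
move=> cf; apply: within_continuousM cf.
by apply: continuous_subspaceT => x; exact: cst_continuous.
Qed.

Lemma within_continuous_add A f g : {within A, continuous f} ->
  {within A, continuous g} -> {within A, continuous (fun x => f x + g x)}.
Proof. exact: within_continuousD. Qed.

Lemma increment_ge a b f df m : a <= b -> {within `[a, b], continuous f} ->
  (forall x, x \in `]a, b[ -> is_derive x 1 f (df x)) ->
  (forall x, x \in `]a, b[ -> m <= df x) -> m * (b - a) <= f b - f a.
Proof.
rewrite le_eqVlt => /predU1P[<-|ab] cf dfx mdf; first by rewrite !subrr mulr0.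
have [c cab ->] := MVT ab dfx cf.
by rewrite ler_wpM2r ?mdf// subr_ge0 ltW.
Qed.

Lemma gronwall_le a b f df (k : R) : a <= b -> {within `[a, b], continuous f} ->
  (forall x, x \in `]a, b[ -> is_derive x 1 f (df x)) ->
  (forall x, x \in `]a, b[ -> k * f x <= df x) ->
  f a <= expR (k * (a - b)) * f b.
Proof.
move=> ab cf dfx kf.
pose e := fun x : R => expR (- k * x).
have de (x : R) : is_derive x (1 : R) e (- k * e x).
  have h := is_derive1_comp (is_derive_expR (- k * x))
    (is_derive_scale (- k) (is_derive_id x (1 : R))).
  by apply: is_derive_eq h _; rewrite mulr1 mulrC.
have ce : {within `[a, b], continuous e}.
  apply: continuous_subspaceT => x; apply: differentiable_continuous.
  by apply/derivable1_diffP; have [] := de x.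
have := @increment_ge a b (fun x => e x * f x)
  (fun x => e x * df x + f x * (- k * e x)) 0 ab (within_continuousM ce cf)
  (fun x xab => is_derive_mul (de x) (dfx x xab)).
rewrite mul0r => /(_ _)/wrap[x xab|].
  have -> : e x * df x + f x * (- k * e x) = e x * (df x - k * f x) by ring.
  by rewrite mulr_ge0 ?expR_ge0// subr_ge0 kf.
rewrite subr_ge0 /e => h.
rewrite -(ler_pM2l (expR_gt0 (- k * a))) (le_trans h)//.
by rewrite mulrA -expRD; have -> : - k * a + k * (a - b) = - k * b by ring.
Qed.

(** Comparing in both directions lets a single lemma serve the two halves of
    the interval, whose Dirichlet endpoints lie on opposite sides. *)
Lemma gronwall a b f df (k x y : R) : 0 <= k ->
  {within `[a, b], continuous f} ->
  (forall t, t \in `]a, b[ -> is_derive t 1 f (df t)) ->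
  (forall t, t \in `]a, b[ -> `|df t| <= k * f t) ->
  (forall t, t \in `[a, b] -> 0 <= f t) ->
  x \in `[a, b] -> y \in `[a, b] -> f y <= expR (k * (b - a)) * f x.
Proof.
move=> k0 cf dfx dfk f0 xab yab.
have sub u v : u \in `[a, b] -> v \in `[a, b] ->
    [/\ {within `[u, v], continuous f},
     (forall t, t \in `]u, v[ -> is_derive t 1 f (df t)) &
     (forall t, t \in `]u, v[ -> `|df t| <= k * f t)].
  rewrite !in_itv /= => /andP[au ub] /andP[av vb].
  have suv t : t \in `]u, v[ -> t \in `]a, b[.
    by rewrite !in_itv /= => /andP[? ?]; rewrite (le_lt_trans au) ?(lt_le_trans _ vb).
  split=> [|t /suv|t /suv]; [|exact: dfx|exact: dfk].
  by apply: continuous_subspaceW cf; apply: subset_itv; rewrite bnd_simp.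
have eb (c : R) : c <= k * (b - a) -> expR c * f x <= expR (k * (b - a)) * f x.
  by move=> hc; rewrite ler_wpM2r ?f0// ler_expR.
have [xy|/ltW yx] := leP x y.
  have [cs ds ks] := sub _ _ xab yab.
  apply: (le_trans _ (eb (k * (y - x)) _)); last first.
    by move: xab yab; rewrite !in_itv /= => /andP[? ?] /andP[? ?]; rewrite ler_wpM2l//; lra.
  have := @gronwall_le x y (fun t => - 1 * f t) (fun t => - 1 * df t) k xy
    (within_continuous_scale (k := -1) cs) (fun t h => is_derive_scale (- 1) (ds t h)).
  move=> /(_ _)/wrap[t /ks|]; first by rewrite ler_norml => /andP[]; lra.
  rewrite !mulN1r mulrN lerNr opprK => h.
  rewrite -(ler_pM2l (expR_gt0 (k * (x - y)))) mulrA -expRD.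
  have -> : k * (x - y) + k * (y - x) = 0 by ring.
  by rewrite expR0 mul1r.
have [cs ds ks] := sub _ _ yab xab.
apply: (le_trans _ (eb (- k * (y - x)) _)); last first.
  move: xab yab; rewrite !in_itv /= => /andP[? ?] /andP[? ?].
  by rewrite mulNr -mulrN ler_wpM2l//; lra.
apply: (@gronwall_le y x f df (- k)) => // t /ks.
by rewrite ler_norml => /andP[]; rewrite mulNr.
Qed.

End Calculus.

(** * The energy of a mode on one half of the interval *)

Section HalfProblem.
Context {R : realType}.
Implicit Types (a b lam K k : R) (sigma q rho u p r : R -> R).

Lemma mul_self_ge0 (x : R) : 0 <= x * x.
Proof. by rewrite -expr2 sqr_ge0. Qed.

Lemma abs_twice_mul_le (x y : R) : `|2 * (x * y)| <= x * x + y * y.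
Proof.
have h1 := mul_self_ge0 (x - y); have h2 := mul_self_ge0 (x + y).
rewrite mulrBl !mulrBr in h1; rewrite mulrDl !mulrDr in h2.
by rewrite (mulrC y x) in h1 h2; rewrite ler_norml; apply/andP; split; lra.
Qed.

(** The equation as a first order system for [u] and the flux [p], with a
    source term [r]: a combination of solutions for two values of [lam] solves
    the system for one of them up to such a source ([flow_lin]). *)
Definition flow a b sigma q rho lam u p r : Prop :=
  [/\ {within `[a, b], continuous u}, {within `[a, b], continuous p},
      forall x, x \in `]a, b[ -> is_derive x 1 u (p x / sigma x) &
      forall x, x \in `]a, b[ ->
        is_derive x 1 p ((q x - lam * rho x) * u x + r x)].

(** Regularity and positivity of the coefficients in quantitative form, with a
    single constant [K] that can be enlarged to serve both halves
    ([coefficients_boundedW]). *)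
Definition coefficients_bounded a b sigma q rho K : Prop :=
  [/\ 0 < K, {within `[a, b], continuous (fun x => rho x * sigma x)},
      exists d : R -> R, forall x, x \in `]a, b[ ->
        is_derive x 1 (fun x => rho x * sigma x) (d x) /\ `|d x| <= K &
      forall x, x \in `[a, b] ->
        [/\ 0 < sigma x <= K, 0 < rho x <= K, 1 <= K * (rho x * sigma x) &
            0 <= q x <= K]].

Definition energy sigma rho lam u p (x : R) : R :=
  lam * (rho x * sigma x * (u x * u x)) + p x * p x.

Lemma flow_lin a b sigma q rho lam mu u p U P (c s : R) :
  flow a b sigma q rho lam u p (fun=> 0) ->
  flow a b sigma q rho mu U P (fun=> 0) ->
  flow a b sigma q rho lam (fun x => c * U x + - s * u x)
    (fun x => c * P x + - s * p x) (fun x => (lam - mu) * rho x * (c * U x)).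
Proof.
move=> [cu cp du dp] [cU cP dU dP]; split.
- by apply: within_continuous_add; exact: within_continuous_scale.
- by apply: within_continuous_add; exact: within_continuous_scale.
- move=> x xab; apply: is_derive_eq.
    by apply: is_derive_add; apply: is_derive_scale; [exact: dU|exact: du].
  by rewrite mulrDl !mulrA.
- move=> x xab; apply: is_derive_eq.
    by apply: is_derive_add; apply: is_derive_scale; [exact: dP|exact: dp].
  by ring.
Qed.

Lemma energy_ge0 a b sigma q rho K lam u p x :
  coefficients_bounded a b sigma q rho K -> 0 <= lam -> x \in `[a, b] ->
  0 <= energy sigma rho lam u p x.
Proof.
move=> [K0 _ _ bd] l0 /bd[/andP[s0 _] /andP[r0 _] _ _].
rewrite /energy; apply: addr_ge0; last exact: mul_self_ge0.
apply: mulr_ge0 => //; apply: mulr_ge0; last exact: mul_self_ge0.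
by rewrite mulr_ge0// ltW.
Qed.

Lemma position_le_energy a b sigma q rho K lam u p x :
  coefficients_bounded a b sigma q rho K -> 0 <= lam -> x \in `[a, b] ->
  lam * (u x * u x) <= K * energy sigma rho lam u p x.
Proof.
move=> [K0 _ _ bd] l0 /bd[_ _ rs _]; rewrite /energy mulrDr.
have h : 0 <= lam * (u x * u x) by apply: mulr_ge0 => //; exact: mul_self_ge0.
have h2 : 0 <= K * (p x * p x) by apply: mulr_ge0; [exact: ltW|exact: mul_self_ge0].
have := ler_wpM2r h rs; rewrite mul1r => h3.
apply: (le_trans h3); rewrite -[leLHS]addr0 lerD// le_eqVlt; apply/orP; left.
by apply/eqP; ring.
Qed.

Lemma energy_le a b sigma q rho K lam u p x :
  coefficients_bounded a b sigma q rho K -> 0 <= lam -> x \in `[a, b] ->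
  energy sigma rho lam u p x <= K * K * (lam * (u x * u x)) + p x * p x.
Proof.
move=> [K0 _ _ bd] l0 /bd[/andP[s0 sK] /andP[r0 rK] _ _]; rewrite /energy lerD2r.
have h : 0 <= lam * (u x * u x) by apply: mulr_ge0 => //; exact: mul_self_ge0.
have -> : lam * (rho x * sigma x * (u x * u x)) =
  (rho x * sigma x) * (lam * (u x * u x)) by ring.
by rewrite ler_wpM2r// ler_pM// ltW.
Qed.

Definition growth K lam0 (l : R) : R := expR ((K * K + K * K / lam0 + K + 1) * l).

(** Solutions oscillate with a frequency of order the square root of [lam], yet
    the energy grows at a rate independent of [lam]:
    [E' = lam (rho sigma)' u^2 + 2 q u p + 2 p r], and each of the three terms is
    bounded by a multiple of [E + m]. *)
Lemma energy_comparison a b sigma q rho K lam0 lam u p r (m x y : R) :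
  coefficients_bounded a b sigma q rho K -> 0 < lam0 -> lam0 <= lam ->
  flow a b sigma q rho lam u p r -> 0 <= m ->
  (forall t, t \in `]a, b[ -> r t * r t <= m) ->
  x \in `[a, b] -> y \in `[a, b] ->
  energy sigma rho lam u p y + m <=
  growth K lam0 (b - a) * (energy sigma rho lam u p x + m).
Proof.
move=> cb l00 l0 fl m0 rm xab yab.
have lam_gt0 : 0 < lam by exact: lt_le_trans l0.
have E0 t : t \in `[a, b] -> 0 <= energy sigma rho lam u p t.
  by move=> tab; apply: energy_ge0 cb _ tab; exact: ltW.
case: (cb) => [K0 crs [d hd] bd].
case: fl => [cu cp du dp].
pose dE t := lam * (rho t * sigma t * (u t * (p t / sigma t) + u t * (p t / sigma t))
      + u t * u t * d t)
  + (p t * ((q t - lam * rho t) * u t + r t) + p t * ((q t - lam * rho t) * u t + r t)) + 0.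
have cE : {within `[a, b], continuous (fun t => energy sigma rho lam u p t + m)}.
  apply: within_continuous_add; last by apply: continuous_subspaceT => z; exact: cst_continuous.
  apply: within_continuous_add; last exact: within_continuousM.
  by apply: within_continuous_scale; apply: within_continuousM => //; exact: within_continuousM.
apply: (@gronwall _ a b (fun t => energy sigma rho lam u p t + m) dE) => //.
- by rewrite !addr_ge0 ?mulr_ge0 ?invr_ge0// ltW.
- move=> t tab.
  apply: (@is_derive_add _ (energy sigma rho lam u p) (fun=> m) t _ 0).
  have [drs _] := hd t tab; have dut := du t tab; have dpt := dp t tab.
  exact: (is_derive_add
    (is_derive_scale lam (is_derive_mul drs (is_derive_mul dut dut)))
    (is_derive_mul dpt dpt)).
- move=> t tab.
  have tab' : t \in `[a, b] by exact: subset_itv_oo_cc tab.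
  have [/andP[s0 sK] /andP[r0 rK] rsK /andP[q0 qK]] := bd t tab'.
  have [_ dK] := hd t tab.
  have rmt := rm t tab.
  have -> : dE t = lam * (u t * u t) * d t + 2 * (q t * (u t * p t)) + 2 * (p t * r t).
    by rewrite /dE; field; rewrite gt_eqF.
  rewrite /energy; set w := lam * (rho t * sigma t * (u t * u t)).
  have lu : lam * (u t * u t) <= K * w.
    have h : 0 <= lam * (u t * u t) by apply: mulr_ge0; [exact: ltW|exact: mul_self_ge0].
    have := ler_wpM2r h rsK; rewrite mul1r /w => /le_trans; apply.
    by rewrite le_eqVlt; apply/orP; left; apply/eqP; ring.
  have uu : u t * u t <= K / lam0 * w.
    rewrite mulrAC ler_pdivlMr// (le_trans _ lu)// mulrC ler_wpM2r//.
    exact: mul_self_ge0.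
  have w0 : 0 <= w by apply: mulr_ge0; [exact: ltW|apply: mulr_ge0; [rewrite mulr_ge0// ltW|exact: mul_self_ge0]].
  have h1 : `|lam * (u t * u t) * d t| <= K * K * w.
    have h : 0 <= lam * (u t * u t) by apply: mulr_ge0; [exact: ltW|exact: mul_self_ge0].
    rewrite normrM (ger0_norm h).
    have -> : K * K * w = K * w * K by ring.
    by rewrite ler_pM.
  have h2 : `|2 * (q t * (u t * p t))| <= K * (K / lam0 * w + p t * p t).
    have h : `|2 * (u t * p t)| <= u t * u t + p t * p t.
      exact: abs_twice_mul_le.
    have -> : 2 * (q t * (u t * p t)) = q t * (2 * (u t * p t)) by ring.
    by rewrite normrM (ger0_norm q0) ler_pM// (le_trans h)// lerD2r.
  have h3 : `|2 * (p t * r t)| <= p t * p t + m.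
    exact: (le_trans (abs_twice_mul_le _ _) (lerD (lexx _) rmt)).
  apply: (le_trans (ler_normD _ _)); apply: (le_trans (lerD (ler_normD _ _) (lexx _))).
  apply: (le_trans (lerD (lerD h1 h2) h3)).
  have l0' : 0 <= lam0^-1 by rewrite invr_ge0 ltW.
  have KK : 0 <= K * K / lam0 by rewrite mulr_ge0 ?mul_self_ge0.
  have pp : 0 <= p t * p t by exact: mul_self_ge0.
  have a1 : 0 <= K * w by rewrite mulr_ge0// ltW.
  have a2 : 0 <= (K * K) * (p t * p t) by rewrite mulr_ge0 ?mul_self_ge0.
  have a3 : 0 <= (K * K + K) * m by rewrite mulr_ge0// addr_ge0 ?mul_self_ge0// ltW.
  have a4 : 0 <= K * K / lam0 * (p t * p t) by rewrite mulr_ge0.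
  have a5 : 0 <= K * K / lam0 * m by rewrite mulr_ge0.
  rewrite -subr_ge0; set D := (X in 0 <= X).
  have -> : D = K * w + K * K * (p t * p t) + (K * K + K) * m
      + K * K / lam0 * (p t * p t) + K * K / lam0 * m + w.
    by rewrite /D; ring.
  by rewrite !addr_ge0.
- by move=> t /E0 Et; rewrite addr_ge0.
Qed.

End HalfProblem.

(** * Two modes on one half of the interval *)

Section Comparison.
Context {R : realType}.
Variables (a b : R) (sigma q rho : R -> R) (K lam0 lam e : R).
Variables (u p : R -> R).
Hypothesis cb : coefficients_bounded a b sigma q rho K.
Hypothesis ab : b = a + 1.
Hypothesis lam0_gt0 : 0 < lam0.
Hypothesis lam0_le : lam0 <= lam.
Hypothesis fu : flow a b sigma q rho lam u p (fun=> 0).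
Hypothesis eab : e \in `[a, b].
Hypothesis ue : u e = 0.

Local Notation k := (growth K lam0 1).
Local Notation E := (energy sigma rho).

Let length1 : b - a = 1. Proof. by rewrite ab addrAC subrr add0r. Qed.
Let K0 : 0 < K. Proof. by case: cb. Qed.
Let lam_gt0 : 0 < lam. Proof. exact: lt_le_trans lam0_le. Qed.

Lemma energy_upper x : x \in `[a, b] -> E lam u p x <= k * (p e * p e).
Proof.
move=> xab.
have := @energy_comparison _ a b sigma q rho K lam0 lam u p _ 0 e x cb lam0_gt0 lam0_le
  fu (lexx _) (fun t _ => _) eab xab.
rewrite !addr0 length1 => /(_ _)/wrap[t|]; first by rewrite mul0r.
by rewrite {2}/energy ue !mul0r !mulr0 add0r.
Qed.

Lemma energy_lower x : x \in `[a, b] -> p e * p e <= k * E lam u p x.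
Proof.
move=> xab.
have := @energy_comparison _ a b sigma q rho K lam0 lam u p _ 0 x e cb lam0_gt0 lam0_le
  fu (lexx _) (fun t _ => _) xab eab.
rewrite !addr0 length1 => /(_ _)/wrap[t|]; first by rewrite mul0r.
by rewrite {1}/energy ue !mul0r !mulr0 add0r.
Qed.

Lemma position_upper x : x \in `[a, b] ->
  lam * (u x * u x) <= K * k * (p e * p e).
Proof.
move=> xab; apply: (le_trans (position_le_energy u p cb (ltW lam_gt0) xab)).
by rewrite -mulrA ler_wpM2l ?energy_upper// ltW.
Qed.

End Comparison.

Section TwoModes.
Context {R : realType}.
Variables (a b : R) (sigma q rho : R -> R) (K lam0 lam mu e : R).
Variables (u p U P : R -> R).
Hypothesis cb : coefficients_bounded a b sigma q rho K.
Hypothesis ab : b = a + 1.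
Hypothesis lam0_gt0 : 0 < lam0.
Hypothesis lam0_le : lam0 <= lam.
Hypothesis lam_le : lam <= mu.
Hypothesis fu : flow a b sigma q rho lam u p (fun=> 0).
Hypothesis fU : flow a b sigma q rho mu U P (fun=> 0).
Hypothesis eab : e \in `[a, b].
Hypothesis ue : u e = 0.
Hypothesis Ue : U e = 0.

Local Notation k := (growth K lam0 1).
Local Notation E := (energy sigma rho).

Let length1 : b - a = 1. Proof. by rewrite ab addrAC subrr add0r. Qed.
Let K0 : 0 < K. Proof. by case: cb. Qed.
Let lam_gt0 : 0 < lam. Proof. exact: lt_le_trans lam0_le. Qed.
Let k0 : 0 < k. Proof. exact: expR_gt0. Qed.

(** A combination of two modes solves the system for [lam] with a source of
    order [delta = mu - lam], and vanishes at the Dirichlet endpoint, so its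
    energy is controlled by its flux there and by [delta^2 / lam]. *)
Lemma energy_difference (c s x : R) : x \in `[a, b] ->
  E lam (fun t => c * U t + - s * u t) (fun t => c * P t + - s * p t) x <=
  k * ((c * P e - s * p e) * (c * P e - s * p e)
       + (mu - lam) * (mu - lam) * (K * K * K * k * (c * c * (P e * P e)) / lam)).
Proof.
move=> xab; set d := mu - lam.
set m := (X in _ <= k * (_ + X)).
have posU t : t \in `[a, b] -> U t * U t <= K * k * (P e * P e) / lam.
  move=> tab; rewrite ler_pdivlMr//.
  apply: (le_trans _ (position_upper cb ab lam0_gt0 (le_trans lam0_le lam_le) fU eab Ue tab)).
  by rewrite mulrC ler_wpM2r// mul_self_ge0.
have m0 : 0 <= m.
  apply: mulr_ge0; first exact: mul_self_ge0.
  apply: divr_ge0; last exact: ltW.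
  apply: mulr_ge0; first by rewrite !mulr_ge0// ltW.
  by rewrite mulr_ge0 ?mul_self_ge0.
have := @energy_comparison _ a b sigma q rho K lam0 lam _ _ _ m e x cb lam0_gt0 lam0_le
  (flow_lin c s fu fU) m0 _ eab xab.
rewrite length1 => /(_ _)/wrap[t tab|].
  have tab' : t \in `[a, b] by exact: subset_itv_oo_cc tab.
  have [_ _ _ /(_ t tab')[_ /andP[r0 rK] _ _]] := cb.
  have -> : (lam - mu) * rho t * (c * U t) * ((lam - mu) * rho t * (c * U t)) =
    (d * d) * ((rho t * rho t) * (c * c * (U t * U t))) by rewrite /d; ring.
  have -> : m = (d * d) * (K * K * (c * c * (K * k * (P e * P e) / lam))).
    by rewrite /m; field; rewrite gt_eqF.
  rewrite ler_wpM2l ?mul_self_ge0//.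
  apply: ler_pM; rewrite ?mul_self_ge0//.
  - by rewrite mulr_ge0 ?mul_self_ge0.
  - by rewrite ler_pM// ltW.
  - by rewrite ler_wpM2l ?mul_self_ge0// posU.
move=> h; apply: (le_trans (y := E lam (fun t => c * U t + - s * u t)
   (fun t => c * P t + - s * p t) x + m)); first by rewrite lerDl.
by move: h; rewrite {2}/energy Ue ue !mulr0 !addr0 !mulr0 add0r mulNr.
Qed.

(** The Wronskian [W = p U - u P] has derivative [(mu - lam) rho u U], and
    [u U >= u^2 / 4 - d^2] for [d = U - s u] and [s >= 1/2].  Since
    [(u p)' = p^2 / sigma + q u^2 - lam rho u^2], adding the term in [u p] trades
    half of [lam rho u^2 / 4] for [p^2 / (8 sigma)], so that the derivative of
    [H] is at least [energy / (8 sigma) - lam rho d^2]. *)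
Lemma lagrange_growth (s m : R)
    (H := fun x => lam / (mu - lam) * (p x * U x + - 1 * (u x * P x))
                   + 8^-1 * (u x * p x)) :
  lam < mu -> 1 / 2 <= s ->
  (forall x, x \in `[a, b] -> lam * ((U x - s * u x) * (U x - s * u x)) <= m) ->
  p e * p e / (8 * k * K) - K * m <= H b - H a.
Proof.
move=> lmu s2 hm.
have d0 : 0 < mu - lam by rewrite subr_gt0.
case: (fu) => [cu cp du dp]; case: (fU) => [cU cP dU dP].
have cH : {within `[a, b], continuous H}.
  apply: within_continuous_add; apply: within_continuous_scale; last exact: within_continuousM.
  apply: within_continuous_add; first exact: within_continuousM.
  by apply: within_continuous_scale; exact: within_continuousM.
have ltab : a <= b by rewrite ab lerDl.
have dH t (tab : t \in `]a, b[) := is_derive_add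
  (is_derive_scale (lam / (mu - lam)) (is_derive_add (is_derive_mul (dp t tab) (dU t tab))
    (is_derive_scale (- 1) (is_derive_mul (du t tab) (dP t tab)))))
  (is_derive_scale 8^-1 (is_derive_mul (du t tab) (dp t tab))).
have := increment_ge (m := p e * p e / (8 * k * K) - K * m) ltab cH dH.
move=> /(_ _)/wrap[t tab|]; last by rewrite length1 mulr1.
have tab' : t \in `[a, b] by exact: subset_itv_oo_cc tab.
have [_ _ _ /(_ t tab')[/andP[s0 sK] /andP[r0 rK] _ /andP[q0 _]]] := cb.
set d := U t - s * u t.
have dm : lam * (d * d) <= m by exact: hm.
have -> : lam / (mu - lam) * (p t * (P t / sigma t) + U t * ((q t - lam * rho t) * u t + 0) +
    - 1 * (u t * ((q t - mu * rho t) * U t + 0) + P t * (p t / sigma t))) +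
    8^-1 * (u t * ((q t - lam * rho t) * u t + 0) + p t * (p t / sigma t)) =
   E lam u p t / (8 * sigma t) + q t * (u t * u t) / 8
   + lam * rho t * (u t * U t - u t * u t / 4).
  by rewrite /energy; field; rewrite !gt_eqF.
have uU : - (d * d) <= u t * U t - u t * u t / 4.
  have -> : U t = s * u t + d by rewrite /d; ring.
  have h1 := mul_self_ge0 (u t / 2 + d).
  have h2 : 0 <= (s - 1 / 2) * (u t * u t) by rewrite mulr_ge0 ?mul_self_ge0 ?subr_ge0.
  have : u t * (s * u t + d) - u t * u t / 4 - - (d * d) =
    (u t / 2 + d) * (u t / 2 + d) + (s - 1 / 2) * (u t * u t) by field.
  by move=> h; rewrite -subr_ge0 h addr_ge0.
have h1 : - (K * m) <= lam * rho t * (u t * U t - u t * u t / 4).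
  apply: (le_trans (y := lam * rho t * - (d * d))); last first.
    by rewrite ler_wpM2l// mulr_ge0// ltW.
  rewrite mulrN lerN2 mulrAC mulrC ler_pM//; first exact: ltW.
  by rewrite mulr_ge0 ?mul_self_ge0 ?ltW.
have h2 : 0 <= q t * (u t * u t) / 8 by rewrite divr_ge0// mulr_ge0 ?mul_self_ge0.
have h3 : p e * p e / (8 * k * K) <= E lam u p t / (8 * sigma t).
  rewrite ler_pdivrMr; last by rewrite !mulr_gt0.
  have -> : E lam u p t / (8 * sigma t) * (8 * k * K) = (k * E lam u p t) * (K / sigma t).
    by field; rewrite gt_eqF.
  have h := energy_lower cb ab lam0_gt0 lam0_le fu eab ue tab'.
  apply: (le_trans h); rewrite -[leLHS]mulr1 ler_wpM2l//.
    by rewrite mulr_ge0 ?(energy_ge0 _ _ cb) ?ltW.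
  by rewrite ler_pdivlMr// mul1r.
by rewrite -addrA addrC in h1 h2 h3 *; lra.
Qed.

End TwoModes.

(** * The interface and the gap *)

Section Interface.
Context {R : realType}.

Lemma sqr_sum2_le (x y : R) : (x + y) * (x + y) <= 2 * (x * x) + 2 * (y * y).
Proof.
have h := mul_self_ge0 (x - y).
have -> : 2 * (x * x) + 2 * (y * y) = (x + y) * (x + y) + (x - y) * (x - y) by ring.
by rewrite lerDl.
Qed.

Lemma sqr_sum3_le (x y z : R) :
  (x + y + z) * (x + y + z) <= 3 * (x * x) + 3 * (y * y) + 3 * (z * z).
Proof.
have -> : 3 * (x * x) + 3 * (y * y) + 3 * (z * z) = (x + y + z) * (x + y + z) +
  ((x - y) * (x - y) + (y - z) * (y - z) + (x - z) * (x - z)) by ring.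
by rewrite lerDl !addr_ge0 ?mul_self_ge0.
Qed.

Lemma sqr_dot_le (al be x y : R) : al * al + be * be = 1 ->
  (be * x - al * y) * (be * x - al * y) <= x * x + y * y.
Proof.
move=> n1; have h := mul_self_ge0 (al * x + be * y).
have -> : x * x + y * y = (al * al + be * be) * (x * x + y * y) by rewrite n1 mul1r.
have -> : (al * al + be * be) * (x * x + y * y) = (be * x - al * y) * (be * x - al * y)
   + (al * x + be * y) * (al * x + be * y) by ring.
by rewrite lerDl.
Qed.

Definition alignment_constant (K k C M lam0 : R) : R :=
  k * (4 * (K * K * C) / lam0 + 9 * (2 * C / lam0 + M * M * C + M * M * C / lam0)
       + 4 * (M * M * C)).

Lemma alignment_constant_gt0 (K k C M lam0 : R) :
  0 < K -> 0 < k -> 0 < C -> 0 < M -> 0 < lam0 ->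
  0 < alignment_constant K k C M lam0.
Proof.
move=> K0 k0 C0 M0 l0; apply: mulr_gt0 => //.
have MMC : 0 < M * M * C by rewrite !mulr_gt0.
apply: addr_gt0; last by rewrite mulr_gt0.
apply: addr_gt0; first by rewrite divr_gt0// !mulr_gt0.
apply: mulr_gt0 => //.
apply: addr_gt0; last by rewrite divr_gt0.
by apply: addr_gt0 => //; rewrite divr_gt0// mulr_gt0.
Qed.

(** Algebra at the interface.  With [D = al B - be A], eliminating [U0], [P1]
    and [P2] expresses [D u0], [D p1] and [D p2] through [d] and the four small
    quantities [al U0 - A u0], [be U0 - B u0], [al P1 - A p1], [be P2 - B p2];
    the energies at the interface being bounded below by multiples of [al^2]
    and [be^2], this bounds [D] itself. *)
Lemma slopes_aligned (K k C M lam0 lam d al be A B u0 p1 p2 U0 P1 P2 : R) :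
  0 < k -> 0 <= C -> 0 < lam0 -> lam0 <= lam ->
  al * al + be * be = 1 -> A * A + B * B = 1 ->
  p1 - p2 = lam * M * u0 -> P1 - P2 = (lam + d) * M * U0 ->
  al * al <= k * (K * K * (lam * (u0 * u0)) + p1 * p1) ->
  be * be <= k * (K * K * (lam * (u0 * u0)) + p2 * p2) ->
  lam * ((al * U0 - A * u0) * (al * U0 - A * u0)) <= C * (d * d) / lam ->
  lam * ((be * U0 - B * u0) * (be * U0 - B * u0)) <= C * (d * d) / lam ->
  (al * P1 - A * p1) * (al * P1 - A * p1) <= C * (d * d) / lam ->
  (be * P2 - B * p2) * (be * P2 - B * p2) <= C * (d * d) / lam ->
  lam * (U0 * U0) <= C ->
  (al * B - be * A) * (al * B - be * A) <=
    alignment_constant K k C M lam0 * (d * d).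
Proof.
move=> k0 C0 l00 l0 n1 n2 jp jP ha hb.
set x1 := al * U0 - A * u0; set x2 := be * U0 - B * u0.
set y1 := al * P1 - A * p1; set y2 := be * P2 - B * p2 => hx1 hx2 hy1 hy2 hU.
have lam_gt0 : 0 < lam by exact: lt_le_trans l0.
set D := al * B - be * A.
have dd0 : 0 <= d * d := mul_self_ge0 d.
have MM0 : 0 <= M * M := mul_self_ge0 M.
have CL : C * (d * d) / lam <= C * (d * d) / lam0.
  by rewrite ler_wpM2l ?lef_pV2// mulr_ge0.
have hl2 (x : R) : lam * (x * x) <= C * (d * d) / lam -> lam * lam * (x * x) <= C * (d * d).
  by rewrite ler_pdivlMr// => h; rewrite -mulrA mulrC.
have Du : D * u0 = be * x1 - al * x2 by rewrite /D /x1 /x2; ring.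
have Du2 : (D * u0) * (D * u0) <= x1 * x1 + x2 * x2 by rewrite Du sqr_dot_le.
have lDu : lam * ((D * u0) * (D * u0)) <= 2 * (C * (d * d) / lam0).
  apply: (le_trans (ler_wpM2l (ltW lam_gt0) Du2)); rewrite mulrDr.
  by have := le_trans hx1 CL; have := le_trans hx2 CL; lra.
have llDu : lam * lam * ((D * u0) * (D * u0)) <= 2 * (C * (d * d)).
  have ll0 : 0 <= lam * lam := mul_self_ge0 lam.
  apply: (le_trans (ler_wpM2l ll0 Du2)); rewrite mulrDr.
  by have := hl2 _ hx1; have := hl2 _ hx2; lra.
have al1 : al * al <= 1 by rewrite -n1 lerDl mul_self_ge0.
have be1 : be * be <= 1 by rewrite -n1 lerDr mul_self_ge0.
have Dp1 : D * p1 = (be * y1 - al * y2) + - (lam * M * al * x2) + - (al * be * d * M * U0).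
  have -> : D * p1 = al * B * (p1 - p2) + al * B * p2 - be * A * p1 by rewrite /D; ring.
  have -> : be * y1 - al * y2 = al * be * (P1 - P2) - be * A * p1 + al * B * p2.
    by rewrite /y1 /y2; ring.
  by rewrite jp jP /x2; ring.
have DDp1 : (D * p1) * (D * p1) <=
    3 * (2 * C / lam0 + M * M * C + M * M * C / lam0) * (d * d).
  rewrite Dp1; apply: (le_trans (sqr_sum3_le _ _ _)); rewrite !mulrNN.
  have h1 := sqr_dot_le y1 y2 n1.
  have h2 : lam * M * al * x2 * (lam * M * al * x2) <= M * M * (C * (d * d)).
    have -> : lam * M * al * x2 * (lam * M * al * x2) =
      M * M * (lam * lam * (x2 * x2) * (al * al)) by ring.
    rewrite ler_wpM2l// -[leRHS]mulr1 ler_pM ?mul_self_ge0 ?hl2//.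
    by rewrite mulr_ge0 ?mul_self_ge0.
  have h3 : al * be * d * M * U0 * (al * be * d * M * U0) <= M * M * (C / lam0 * (d * d)).
    have -> : al * be * d * M * U0 * (al * be * d * M * U0) =
      M * M * (((al * al) * (be * be)) * (U0 * U0) * (d * d)) by ring.
    rewrite ler_wpM2l// ler_wpM2r// -[leRHS]mul1r ler_pM ?mul_self_ge0//.
    - by rewrite mulr_ge0 ?mul_self_ge0.
    - by rewrite mulr_ile1 ?mul_self_ge0.
    - by rewrite ler_pdivlMr// (le_trans _ hU)// mulrC ler_wpM2r// mul_self_ge0.
  have h4 : y1 * y1 <= C / lam0 * (d * d) by rewrite mulrAC (le_trans hy1).
  have h5 : y2 * y2 <= C / lam0 * (d * d) by rewrite mulrAC (le_trans hy2).
  have -> : 3 * (2 * C / lam0 + M * M * C + M * M * C / lam0) * (d * d) =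
    3 * (C / lam0 * (d * d) + C / lam0 * (d * d)) + 3 * (M * M * (C * (d * d)))
     + 3 * (M * M * (C / lam0 * (d * d))) by ring.
  by lra.
have DDp2 : (D * p2) * (D * p2) <=
    6 * (2 * C / lam0 + M * M * C + M * M * C / lam0) * (d * d) + 4 * (M * M * C) * (d * d).
  have -> : D * p2 = D * p1 + - (lam * M * (D * u0)).
    have -> : D * p2 = D * p1 - D * (p1 - p2) by ring.
    by rewrite jp; ring.
  apply: (le_trans (sqr_sum2_le _ _)); rewrite mulrNN.
  have h : lam * M * (D * u0) * (lam * M * (D * u0)) <= M * M * (2 * (C * (d * d))).
    have -> : lam * M * (D * u0) * (lam * M * (D * u0)) =
      M * M * (lam * lam * ((D * u0) * (D * u0))) by ring.
    by rewrite ler_wpM2l.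
  have -> : 4 * (M * M * C) * (d * d) = 2 * (M * M * (2 * (C * (d * d)))) by ring.
  have -> : 6 * (2 * C / lam0 + M * M * C + M * M * C / lam0) * (d * d) =
    2 * (3 * (2 * C / lam0 + M * M * C + M * M * C / lam0) * (d * d)) by ring.
  by lra.
have KD : K * K * (lam * ((D * u0) * (D * u0))) <= K * K * (2 * (C * (d * d) / lam0)).
  by rewrite ler_wpM2l ?mul_self_ge0.
have DD0 : 0 <= D * D := mul_self_ge0 D.
have hD (ga p : R) : ga * ga <= k * (K * K * (lam * (u0 * u0)) + p * p) ->
    D * D * (ga * ga) <= k * (K * K * (lam * ((D * u0) * (D * u0))) + (D * p) * (D * p)).
  move=> h; apply: (le_trans (ler_wpM2l DD0 h)).
  by rewrite le_eqVlt; apply/orP; left; apply/eqP; ring.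
rewrite -[leLHS]mulr1 -n1 mulrDr.
apply: (le_trans (lerD (hD _ _ ha) (hD _ _ hb))).
rewrite -(mulrDr k) /alignment_constant -(mulrA k) ler_pM2l//.
have -> : (4 * (K * K * C) / lam0 + 9 * (2 * C / lam0 + M * M * C + M * M * C / lam0)
       + 4 * (M * M * C)) * (d * d) = K * K * (2 * (C * (d * d) / lam0)) + K * K * (2 * (C * (d * d) / lam0))
   + 3 * (2 * C / lam0 + M * M * C + M * M * C / lam0) * (d * d) +
   (6 * (2 * C / lam0 + M * M * C + M * M * C / lam0) * (d * d) + 4 * (M * M * C) * (d * d)) by ring.
by lra.
Qed.

Lemma flow_scale (a b : R) (sigma q rho : R -> R) lam (u p : R -> R) (c : R) :
  flow a b sigma q rho lam u p (fun=> 0) ->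
  flow a b sigma q rho lam (fun x => c * u x) (fun x => c * p x) (fun=> 0).
Proof.
move=> [cu cp du dp]; split; try exact: within_continuous_scale.
- move=> x xab; apply: is_derive_eq; first by apply: is_derive_scale; exact: du.
  by rewrite mulrA.
- move=> x xab; apply: is_derive_eq; first by apply: is_derive_scale; exact: dp.
  by ring.
Qed.

Variables (M K lam0 : R) (sigma1 q1 rho1 sigma2 q2 rho2 : R -> R).
Hypothesis cb1 : coefficients_bounded (- 1) 0 sigma1 q1 rho1 K.
Hypothesis cb2 : coefficients_bounded 0 1 sigma2 q2 rho2 K.
Hypothesis M0 : 0 < M.
Hypothesis lam0_gt0 : 0 < lam0.

(** The endpoint fluxes [p (- 1)] and [w 1] determine the mode, hence the choice
    of normalisation. *)
Definition normalized_mode lam (u p v w : R -> R) : Prop :=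
  [/\ flow (- 1) 0 sigma1 q1 rho1 lam u p (fun=> 0),
      flow 0 1 sigma2 q2 rho2 lam v w (fun=> 0),
      [/\ u (- 1) = 0, v 1 = 0 & u 0 = v 0],
      p 0 - w 0 = lam * M * u 0 &
      p (- 1) * p (- 1) + w 1 * w 1 = 1].

Lemma normalized_mode_opp lam u p v w : normalized_mode lam u p v w ->
  normalized_mode lam (fun x => - 1 * u x) (fun x => - 1 * p x)
    (fun x => - 1 * v x) (fun x => - 1 * w x).
Proof.
move=> [fu fv [u1 v1 uv] j n]; split; try exact: flow_scale.
- by rewrite u1 v1 uv !mulr0.
- by rewrite -mulrBr j; ring.
- by rewrite -[RHS]n; ring.
Qed.

Local Notation k := (growth K lam0 1).
Local Notation C := ((K + 1) * k * (K * K * K * k) + K * k).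
Local Notation C1 := (alignment_constant K k C M lam0).
Local Notation D := (K * k * (C1 + K * K * K * k / lam0)).

Let k0 : 0 < k. Proof. exact: expR_gt0. Qed.
Let K0 : 0 < K. Proof. by case: cb1. Qed.
Let Kk0 : 0 < K * K * K * k. Proof. by rewrite !mulr_gt0. Qed.
Let C_gt0 : 0 < C.
Proof. by rewrite addr_gt0 ?mulr_gt0// addr_gt0. Qed.
Let m10 : (- 1 : R) \in `[(- 1 : R), 0]. Proof. by rewrite in_itv /= lexx lerN10. Qed.
Let z10 : (0 : R) \in `[(- 1 : R), 0]. Proof. by rewrite in_itv /= lexx lerN10. Qed.
Let z01 : (0 : R) \in `[(0 : R), 1]. Proof. by rewrite in_itv /= lexx ler01. Qed.
Let p01 : (1 : R) \in `[(0 : R), 1]. Proof. by rewrite in_itv /= lexx ler01. Qed.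
Let len1 : (0 : R) = - 1 + 1. Proof. by rewrite addNr. Qed.
Let len2 : (1 : R) = 0 + 1. Proof. by rewrite add0r. Qed.

(* What [slopes_aligned] needs about the interface [z], seen from either half. *)
Let end_bounds a b sigma q rho e z lam mu u p U P :
  coefficients_bounded a b sigma q rho K -> b = a + 1 ->
  lam0 <= lam -> lam <= mu -> e \in `[a, b] -> z \in `[a, b] ->
  flow a b sigma q rho lam u p (fun=> 0) ->
  flow a b sigma q rho mu U P (fun=> 0) -> u e = 0 -> U e = 0 ->
  p e * p e <= 1 -> P e * P e <= 1 ->
  [/\ p e * p e <= k * (K * K * (lam * (u z * u z)) + p z * p z),
      lam * ((p e * U z - P e * u z) * (p e * U z - P e * u z)) <=
        C * ((mu - lam) * (mu - lam)) / lam,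
      (p e * P z - P e * p z) * (p e * P z - P e * p z) <=
        C * ((mu - lam) * (mu - lam)) / lam &
      lam * (U z * U z) <= C].
Proof.
move=> cb ab l0 lmu eab zab fu fU ue Ue pe Pe.
have lam_gt0 : 0 < lam by exact: lt_le_trans l0.
have h1 := energy_lower cb ab lam0_gt0 l0 fu eab ue zab.
have h2 := energy_le u p cb (ltW lam_gt0) zab.
have h3 := position_upper cb ab lam0_gt0 (le_trans l0 lmu) fU eab Ue zab.
have h4 := energy_difference cb ab lam0_gt0 l0 lmu fu fU eab ue Ue (p e) (P e) zab.
have h5 := position_le_energy (fun t => p e * U t + - P e * u t)
  (fun t => p e * P t + - P e * p t) cb (ltW lam_gt0) zab.
set dd := (mu - lam) * (mu - lam).
have dd0 : 0 <= dd := mul_self_ge0 _.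
have en : energy sigma rho lam (fun t => p e * U t + - P e * u t)
  (fun t => p e * P t + - P e * p t) z <= k * (K * K * K * k) * dd / lam.
  apply: (le_trans h4); rewrite (mulrC (P e)) subrr mul0r add0r -/dd.
  have -> : k * (K * K * K * k) * dd / lam = k * (dd * (K * K * K * k * 1 / lam)) by ring.
  rewrite ler_pM2l// ler_wpM2l// ler_pM2r ?invr_gt0//.
  by rewrite ler_pM2l// mulr_ile1 ?mul_self_ge0.
have ll0 : 0 <= lam^-1 by rewrite invr_ge0 ltW.
have CC : (K + 1) * (k * (K * K * K * k) * dd / lam) <= C * dd / lam.
  rewrite -subr_ge0.
  have -> : C * dd / lam - (K + 1) * (k * (K * K * K * k) * dd / lam) = K * k * dd * lam^-1 by ring.
  by rewrite mulr_ge0// mulr_ge0// mulr_ge0// ltW.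
have E0 := energy_ge0 (fun t => p e * U t + - P e * u t)
  (fun t => p e * P t + - P e * p t) cb (ltW lam_gt0) zab.
split.
- by apply: (le_trans h1); rewrite ler_pM2l.
- rewrite mulNr in h5; apply: (le_trans h5); apply: (le_trans _ CC).
  apply: (le_trans (ler_wpM2l (ltW K0) en)).
  by rewrite ler_wpM2r ?lerDl// (le_trans E0 en).
- rewrite -mulNr; apply: (le_trans _ CC); rewrite [leRHS]mulrDl mul1r.
  apply: (le_trans (y := 0 + k * (K * K * K * k) * dd / lam)); last first.
    by rewrite lerD2r mulr_ge0 ?(le_trans E0 en)// ltW.
  rewrite add0r; apply: (le_trans _ en); rewrite /energy lerDr.
  have [_ _ _ /(_ z zab)[/andP[s0 _] /andP[r0 _] _ _]] := cb.
  apply: mulr_ge0; first exact: ltW.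
  by apply: mulr_ge0; [rewrite mulr_ge0// ltW|exact: mul_self_ge0].
- have mu1 : lam * (U z * U z) <= mu * (U z * U z) by rewrite ler_wpM2r// mul_self_ge0.
  apply: (le_trans mu1); apply: (le_trans h3).
  apply: (le_trans (y := K * k * 1)); first by rewrite ler_pM2l// mulr_gt0.
  rewrite mulr1 lerDr !mulr_ge0// ?ltW// addr_gt0//.
Qed.

Let sum1 (x y : R) : x * x + y * y = 1 -> x * x <= 1 /\ y * y <= 1.
Proof. by move=> <-; rewrite lerDl lerDr !mul_self_ge0. Qed.

Lemma end_slopes_aligned lam mu u p v w U P V Q :
  lam0 <= lam -> lam <= mu ->
  normalized_mode lam u p v w -> normalized_mode mu U P V Q ->
  (p (- 1) * Q 1 - w 1 * P (- 1)) * (p (- 1) * Q 1 - w 1 * P (- 1)) <=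
    C1 * ((mu - lam) * (mu - lam)).
Proof.
move=> l0 lmu [fu fv [u1 v1 uv] j n] [fU fV [U1 V1 UV] jj nn].
have [n1 n2] := sum1 n; have [nn1 nn2] := sum1 nn.
have [a1 a2 a3 a4] := end_bounds cb1 len1 l0 lmu m10 z10 fu fU u1 U1 n1 nn1.
have [b1 b2 b3 b4] := end_bounds cb2 len2 l0 lmu p01 z01 fv fV v1 V1 n2 nn2.
rewrite -uv -UV in b1 b2 b4.
apply: (slopes_aligned k0 (ltW C_gt0) lam0_gt0 l0 n nn j _ a1 b1 a2 b2 a3 b3 a4).
by rewrite jj addrC subrK.
Qed.

(* For [s] the inner product of the two vectors of endpoint fluxes, [U - s u]
   has small flux at the Dirichlet endpoint, hence is small everywhere. *)
Let side_difference a b sigma q rho e lam mu u p U P (s : R) :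
  coefficients_bounded a b sigma q rho K -> b = a + 1 ->
  lam0 <= lam -> lam <= mu -> e \in `[a, b] ->
  flow a b sigma q rho lam u p (fun=> 0) ->
  flow a b sigma q rho mu U P (fun=> 0) -> u e = 0 -> U e = 0 ->
  P e * P e <= 1 ->
  (P e - s * p e) * (P e - s * p e) <= C1 * ((mu - lam) * (mu - lam)) ->
  forall x, x \in `[a, b] ->
    lam * ((U x - s * u x) * (U x - s * u x)) <= D * ((mu - lam) * (mu - lam)).
Proof.
move=> cb ab l0 lmu eab fu fU ue Ue Pe hP x xab.
have lam_gt0 : 0 < lam by exact: lt_le_trans l0.
have h4 := energy_difference cb ab lam0_gt0 l0 lmu fu fU eab ue Ue 1 s xab.
have h5 := position_le_energy (fun t => 1 * U t + - s * u t)
  (fun t => 1 * P t + - s * p t) cb (ltW lam_gt0) xab.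
rewrite mul1r mulNr in h5; apply: (le_trans h5).
set dd := (mu - lam) * (mu - lam) in hP *.
have dd0 : 0 <= dd := mul_self_ge0 _.
have -> : D * dd = K * (k * (C1 * dd + K * K * K * k / lam0 * dd)) by ring.
rewrite ler_pM2l//; apply: (le_trans h4); rewrite ler_pM2l// !mul1r -/dd lerD//.
rewrite mulrC ler_wpM2r// ler_pM//.
- by rewrite mulr_ge0 ?mul_self_ge0// ltW.
- by rewrite invr_ge0 ltW.
- by rewrite -[leRHS]mulr1 ler_pM2l.
- by rewrite lef_pV2.
Qed.

(** The contributions of the two halves to the Lagrange identity add up to
    [lam M (u(0)^2 / 8 - u(0) U(0))] at the interface.  They are bounded below by
    a positive constant up to [O(delta^2)], whereas this expression is
    at most [lam M (U(0) - s u(0))^2 = O(delta^2)]. *)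
Lemma aligned_modes_gap lam mu u p v w U P V Q :
  lam0 <= lam -> lam < mu ->
  normalized_mode lam u p v w -> normalized_mode mu U P V Q ->
  1 / 2 <= p (- 1) * P (- 1) + w 1 * Q 1 ->
  1 / (8 * k * K) <= (2 * K + M) * D * ((mu - lam) * (mu - lam)).
Proof.
move=> l0 lmu md mD; set s := (X in _ <= X) => s2.
have De := end_slopes_aligned l0 (ltW lmu) md mD.
have lam_gt0 : 0 < lam by exact: lt_le_trans l0.
case: md mD De => [fu fv [u1 v1 uv] j n] [fU fV [U1 V1 UV] jj nn] De.
have [n1 n2] := sum1 n; have [nn1 nn2] := sum1 nn.
set dd := (mu - lam) * (mu - lam) in De *.
set al := p (- 1) in n n1 De s s2; set be := w 1 in n n2 De s s2.
set A := P (- 1) in nn nn1 De s s2; set B := Q 1 in nn nn2 De s s2.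
(* As [(al, be)] is a unit vector, the component of [(A, B)] orthogonal to it
   is [(- be, al)] times [al B - be A]. *)
have e1 : (A - s * al) * (A - s * al) <= C1 * dd.
  have -> : A - s * al = - be * (al * B - be * A).
    by rewrite -[X in X - _]mul1r -n /s; ring.
  rewrite mulrACA mulrNN -[leRHS]mul1r ler_pM ?mul_self_ge0//.
have e2 : (B - s * be) * (B - s * be) <= C1 * dd.
  have -> : B - s * be = al * (al * B - be * A).
    by rewrite -[X in X - _]mul1r -n /s; ring.
  by rewrite mulrACA -[leRHS]mul1r ler_pM ?mul_self_ge0.
have d1 := side_difference cb1 len1 l0 (ltW lmu) m10 fu fU u1 U1 nn1 e1.
have d2 := side_difference cb2 len2 l0 (ltW lmu) p01 fv fV v1 V1 nn2 e2.
have g1 := lagrange_growth cb1 len1 lam0_gt0 l0 fu fU m10 u1 lmu s2 d1.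
have g2 := lagrange_growth cb2 len2 lam0_gt0 l0 fv fV p01 v1 lmu s2 d2.
move: g1 g2; rewrite u1 v1 U1 V1 -uv -UV !mul0r !mulr0 !addr0 !mulr0 !subr0 sub0r.
rewrite -/al -/be -/dd => g1 g2.
have hd := d1 0 z10.
have dne : mu - lam != 0 by rewrite subr_eq0 gt_eqF.
have key : lam / (mu - lam) * (p 0 * U 0 + -1 * (u 0 * P 0)) + 8^-1 * (u 0 * p 0)
   - (lam / (mu - lam) * (w 0 * U 0 + -1 * (u 0 * Q 0)) + 8^-1 * (u 0 * w 0))
   = lam * M * (u 0 * u 0 / 8 - u 0 * U 0).
  transitivity (lam / (mu - lam) * ((p 0 - w 0) * U 0 - u 0 * (P 0 - Q 0)) +
     8^-1 * (u 0 * (p 0 - w 0))); first by ring.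
  by rewrite j jj; field.
have uU : u 0 * u 0 / 8 - u 0 * U 0 <= (U 0 - s * u 0) * (U 0 - s * u 0).
  set d := U 0 - s * u 0; have -> : U 0 = s * u 0 + d by rewrite /d; ring.
  have h1 := mul_self_ge0 (u 0 / 2 + d).
  have h2 : 0 <= (s - 3 / 8) * (u 0 * u 0) by rewrite mulr_ge0 ?mul_self_ge0//; lra.
  have : d * d - (u 0 * u 0 / 8 - u 0 * (s * u 0 + d)) =
    (u 0 / 2 + d) * (u 0 / 2 + d) + (s - 3 / 8) * (u 0 * u 0) by field.
  by move=> h; rewrite -subr_ge0 h addr_ge0.
have bd : lam * M * (u 0 * u 0 / 8 - u 0 * U 0) <= M * (D * dd).
  apply: (le_trans (y := lam * M * ((U 0 - s * u 0) * (U 0 - s * u 0)))).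
    by rewrite ler_pM2l// mulr_gt0.
  have -> : lam * M * ((U 0 - s * u 0) * (U 0 - s * u 0)) =
    M * (lam * ((U 0 - s * u 0) * (U 0 - s * u 0))) by ring.
  by rewrite (ler_pM2l M0).
have -> : 1 / (8 * k * K) = al * al / (8 * k * K) + be * be / (8 * k * K).
  by rewrite -mulrDl n.
have -> : (2 * K + M) * D * dd = 2 * (K * (D * dd)) + M * (D * dd) by ring.
by rewrite -key in bd; lra.
Qed.

(** The vectors of endpoint fluxes satisfy [s^2 + (al B - be A)^2 = 1], [s] being
    their inner product.  Either [|s| >= 1/2], and the modes are aligned up to
    the sign of one of them, or [(al B - be A)^2 >= 3/4] and
    [end_slopes_aligned] already bounds the gap. *)
Lemma normalized_modes_gap : exists2 delta : R, 0 < delta &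
  forall lam mu u p v w U P V Q, lam0 <= lam -> lam < mu ->
    normalized_mode lam u p v w -> normalized_mode mu U P V Q ->
    delta <= mu - lam.
Proof.
have C10 : 0 < C1 by exact: alignment_constant_gt0.
have D0 : 0 < D.
  apply: mulr_gt0; first exact: mulr_gt0.
  apply: addr_gt0; first exact: C10.
  exact: divr_gt0.
have KM : 0 < 2 * K + M by rewrite addr_gt0// mulr_gt0.
set c1 := 3 / 4 / C1; set c2 := 1 / (8 * k * K) / ((2 * K + M) * D).
have c10 : 0 < c1 by rewrite divr_gt0.
have c20 : 0 < c2.
  apply: divr_gt0; last exact: mulr_gt0.
  by apply: divr_gt0 => //; rewrite !mulr_gt0.
(* The estimates bound the square of the gap: the minimum with 1 makes up for
   the missing square root. *)
exists (Num.min 1 (Num.min c1 c2)); first by rewrite !lt_min ltr01 c10.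
move=> lam mu u p v w U P V Q l0 lmu md mD.
have d0 : 0 < mu - lam by rewrite subr_gt0.
suff : Num.min c1 c2 <= (mu - lam) * (mu - lam).
  move=> h; rewrite ge_min; have [//|/ltW d1] := leP 1 (mu - lam).
  by rewrite (le_trans h)// ler_piMl// ltW.
set s := p (- 1) * P (- 1) + w 1 * Q 1.
have al := end_slopes_aligned l0 (ltW lmu) md mD.
have gap (U' P' V' Q' : R -> R) : normalized_mode mu U' P' V' Q' ->
    1 / 2 <= p (- 1) * P' (- 1) + w 1 * Q' 1 -> Num.min c1 c2 <= (mu - lam) * (mu - lam).
  move=> mD' s2; rewrite ge_min; apply/orP; right.
  rewrite ler_pdivrMr; last exact: mulr_gt0.
  rewrite [leRHS]mulrC; exact: (aligned_modes_gap l0 lmu md mD').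
have [s1|s1] := leP (1 / 2) s; first exact: (gap U P V Q).
have [s2|s2] := leP s (- (1 / 2)).
  apply: (gap _ _ _ _ (normalized_mode_opp mD)).
  have -> : p (-1) * (-1 * P (-1)) + w 1 * (-1 * Q 1) = - s by rewrite /s; ring.
  by rewrite lerNr.
rewrite ge_min; apply/orP; left; rewrite ler_pdivrMr// [leRHS]mulrC.
apply: (le_trans _ al).
case: md mD => [_ _ _ _ n] [_ _ _ _ nn].
have e : (p (-1) * Q 1 - w 1 * P (-1)) * (p (-1) * Q 1 - w 1 * P (-1)) =
  (p (-1) * p (-1) + w 1 * w 1) * (P (-1) * P (-1) + Q 1 * Q 1) - s * s.
  by rewrite /s; ring.
rewrite n nn mulr1 in e.
rewrite e; have : 0 <= (s + 1 / 2) * (1 / 2 - s) by rewrite mulr_ge0 ?subr_ge0 ?ltW//; lra.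
by lra.
Qed.

End Interface.

(** * Smoothed ramps *)

Section SmoothedRamp.
Context {R : realType}.
Implicit Types (c h t x y : R) (f : R -> R).

Definition slope f x y : R := (f y - f x) / (y - x).

Definition ramp c t : R := Num.max (t - c) 0.

Lemma ramp_l c t : t <= c -> ramp c t = 0.
Proof. by move=> h; apply/max_idPr; rewrite subr_le0. Qed.

Lemma ramp_r c t : c <= t -> ramp c t = t - c.
Proof. by move=> h; apply/max_idPl; rewrite subr_ge0. Qed.

Lemma ramp_cts c : continuous (ramp c).
Proof.
move=> t; apply: (@continuous_max _ _ (fun t => t - c) (fun=> 0)).
  by apply: continuousB; [exact: cvg_id|exact: cst_continuous].
exact: cst_continuous.
Qed.

Lemma is_derive_of_slopes f x (g : R) :
  (forall e, 0 < e -> exists2 r, 0 < r & forall y, y != x -> `|y - x| < r ->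
    `|g - slope f x y| <= e) -> is_derive x 1 f g.
Proof.
move=> H.
suff L : (fun h : R => h^-1 *: ((f \o shift x) (h *: (1 : R)) - f x)) @ (0 : R)^' --> g.
  by apply: DeriveDef; [exact: (cvgP _ L)|exact: (cvg_lim _ L)].
apply/cvgrPdist_le => e e0; have [r r0 hr] := H e e0.
near=> h.
have h0 : h != 0 by near: h; exact: nbhs_dnbhs_neq.
have -> : h^-1 *: ((f \o shift x) (h *: (1 : R)) - f x) = (f (h + x) - f x) / (h + x - x).
  by rewrite addrK /= [h *: 1]mulr1 mulrC.
apply: (hr (h + x)); first by rewrite -subr_eq0 addrK.
rewrite addrK; near: h; apply: dnbhs0_lt => //.
Unshelve. all: by end_near. Qed.

Lemma is_derive_sqr_ramp c x :
  is_derive x 1 (fun t => ramp c t * ramp c t) (2 * ramp c x).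
Proof.
apply: is_derive_of_slopes => e e0; exists e => // y yx ye; rewrite /slope.
apply: (le_trans _ (ltW ye)).
have d0 : y - x != 0 by rewrite subr_eq0.
have -> : 2 * ramp c x - (ramp c y * ramp c y - ramp c x * ramp c x) / (y - x) =
  (2 * ramp c x * (y - x) - (ramp c y * ramp c y - ramp c x * ramp c x)) / (y - x).
  by field.
rewrite normrM normfV ler_pdivrMr ?normr_gt0// -normrM [leRHS]ger0_norm ?mul_self_ge0//.
have [yc|/ltW yc] := leP y c; have [xc|/ltW xc] := leP x c;
  rewrite ?(ramp_l yc) ?(ramp_r yc) ?(ramp_l xc) ?(ramp_r xc) ler_norml;
  apply/andP; split; nra.
Qed.

Lemma is_derive_cube_ramp c x :
  is_derive x 1 (fun t => ramp c t * ramp c t * ramp c t) (3 * (ramp c x * ramp c x)).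
Proof.
have -> : (fun t => ramp c t * ramp c t * ramp c t) =
    (fun t => (t + - c) * (ramp c t * ramp c t)).
  apply/funext => t; have [tc|/ltW tc] := leP t c.
    by rewrite (ramp_l tc) !mulr0.
  by rewrite (ramp_r tc) mulrA.
apply: is_derive_eq.
  exact: (is_derive_mul
    (is_derive_add (is_derive_id x (1 : R)) (is_derive_cst (- c) x (1 : R)))
    (is_derive_sqr_ramp c x)).
have [tc|/ltW tc] := leP x c; first by rewrite (ramp_l tc) !(mulr0, mul0r, addr0).
by rewrite (ramp_r tc) addr0 mulr1 /=; ring.
Qed.

(** Second differences of powers of [ramp c], in other words cardinal B-splines
    and their primitives: [tent c h] has mass one and is supported between [c] and
    [c + 2h], and [soft_ramp c h], its second primitive, is a twice
    continuously differentiable ramp. *)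
Definition tent c h t : R :=
  (ramp c t + - 2 * ramp (c + h) t + ramp (c + 2 * h) t) / (h * h).
Definition soft_step c h t : R :=
  (ramp c t * ramp c t + - 2 * (ramp (c + h) t * ramp (c + h) t)
   + ramp (c + 2 * h) t * ramp (c + 2 * h) t) / (2 * (h * h)).
Definition soft_ramp c h t : R :=
  (ramp c t * ramp c t * ramp c t
   + - 2 * (ramp (c + h) t * ramp (c + h) t * ramp (c + h) t)
   + ramp (c + 2 * h) t * ramp (c + 2 * h) t * ramp (c + 2 * h) t) / (6 * (h * h)).

Lemma tent_cts c h : continuous (tent c h).
Proof.
move=> t; rewrite /tent.
have c1 (k : R) : {for t, continuous (fun=> k)} by exact: cst_continuous.
have cr k : {for t, continuous (ramp k)} by exact: ramp_cts.
exact: (continuousM (continuousD (continuousD (cr c) (continuousM (c1 (- 2)) (cr (c + h))))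
  (cr (c + 2 * h))) (c1 _)).
Qed.

Lemma is_derive_soft_step c h x : 0 < h ->
  is_derive x 1 (soft_step c h) (tent c h x).
Proof.
move=> h0; have hn : h != 0 by rewrite gt_eqF.
have -> : soft_step c h = (fun t => (2 * (h * h))^-1 * (ramp c t * ramp c t
   + - 2 * (ramp (c + h) t * ramp (c + h) t)
   + ramp (c + 2 * h) t * ramp (c + 2 * h) t)).
  by apply/funext => t; rewrite mulrC.
apply: is_derive_eq.
  exact: (is_derive_scale _ (is_derive_add (is_derive_add (is_derive_sqr_ramp _ x)
    (is_derive_scale _ (is_derive_sqr_ramp _ x))) (is_derive_sqr_ramp _ x))).
by rewrite /tent; field.
Qed.

Lemma is_derive_soft_ramp c h x : 0 < h ->
  is_derive x 1 (soft_ramp c h) (soft_step c h x).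
Proof.
move=> h0; have hn : h != 0 by rewrite gt_eqF.
have -> : soft_ramp c h = (fun t => (6 * (h * h))^-1 * (ramp c t * ramp c t * ramp c t
   + - 2 * (ramp (c + h) t * ramp (c + h) t * ramp (c + h) t)
   + ramp (c + 2 * h) t * ramp (c + 2 * h) t * ramp (c + 2 * h) t)).
  by apply/funext => t; rewrite mulrC.
apply: is_derive_eq.
  exact: (is_derive_scale _ (is_derive_add (is_derive_add (is_derive_cube_ramp _ x)
    (is_derive_scale _ (is_derive_cube_ramp _ x))) (is_derive_cube_ramp _ x))).
by rewrite /soft_step; field.
Qed.

Let ramp_cases c h t (P : R -> R -> R -> Prop) : 0 < h ->
  (t <= c -> P 0 0 0) ->
  (c <= t <= c + h -> P (t - c) 0 0) ->
  (c + h <= t <= c + 2 * h -> P (t - c) (t - (c + h)) 0) ->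
  (c + 2 * h <= t -> P (t - c) (t - (c + h)) (t - (c + 2 * h))) ->
  P (ramp c t) (ramp (c + h) t) (ramp (c + 2 * h) t).
Proof.
move=> h0 P0 P1 P2 P3.
have [t0|/ltW t0] := leP t c.
  by rewrite !ramp_l; [exact: P0|lra..].
have [t1|/ltW t1] := leP t (c + h).
  by rewrite (ramp_r t0) (ramp_l t1) ramp_l; [apply: P1; rewrite t0|lra].
have [t2|/ltW t2] := leP t (c + 2 * h).
  by rewrite (ramp_r t0) (ramp_r t1) (ramp_l t2); apply: P2; rewrite t1.
by rewrite (ramp_r t0) (ramp_r t1) (ramp_r t2); exact: P3.
Qed.

Lemma tent_ge0 c h t : 0 < h -> 0 <= tent c h t.
Proof.
move=> h0; apply: divr_ge0; last exact: mul_self_ge0.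
by elim/ramp_cases: _ => //; lra.
Qed.

Lemma tent_out c h t : 0 < h -> t <= c \/ c + 2 * h <= t -> tent c h t = 0.
Proof.
move=> h0 [tc|tc]; rewrite /tent.
  by rewrite !ramp_l ?mulr0 ?addr0 ?mul0r//; lra.
by rewrite !ramp_r; lra.
Qed.

Lemma soft_step_l c h t : 0 < h -> t <= c -> soft_step c h t = 0.
Proof.
by move=> h0 tc; rewrite /soft_step !ramp_l ?mulr0 ?addr0 ?mul0r//; lra.
Qed.

Lemma soft_step_r c h t : 0 < h -> c + 2 * h <= t -> soft_step c h t = 1.
Proof.
by move=> h0 tc; rewrite /soft_step !ramp_r; [field; rewrite gt_eqF|lra..].
Qed.

Lemma soft_step_itv c h t : 0 < h -> 0 <= soft_step c h t <= 1.
Proof.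
move=> h0.
have ic u v : u <= v -> soft_step c h u <= soft_step c h v.
  move=> uv; rewrite -subr_ge0.
  have := @increment_ge _ u v (soft_step c h) (tent c h) 0 uv.
  rewrite mul0r; apply=> [|z _|z _].
  - apply: derivable_within_continuous => z _.
    by have [] := is_derive_soft_step c z h0.
  - exact: is_derive_soft_step.
  - exact: tent_ge0.
apply/andP; split.
  have [tc|/ltW tc] := leP t c; first by rewrite soft_step_l.
  by have := ic _ _ tc; rewrite (soft_step_l h0 (lexx c)).
have [tc|/ltW tc] := leP t (c + 2 * h); last by rewrite soft_step_r.
by have := ic _ _ tc; rewrite (soft_step_r h0 (lexx (c + 2 * h))).
Qed.

Lemma soft_ramp_increment c h u v : 0 < h -> u <= v ->
  0 <= soft_ramp c h v - soft_ramp c h u <= v - u.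
Proof.
move=> h0 uv.
have cR : {within `[u, v], continuous (soft_ramp c h)}.
  apply: derivable_within_continuous => z _.
  by have [] := is_derive_soft_ramp c z h0.
have [z _ ->] := MVT_segment uv (fun z _ => is_derive_soft_ramp c z h0) cR.
have /andP[s0 s1] := soft_step_itv c z h0.
by rewrite mulr_ge0 ?subr_ge0//= -[leRHS]mul1r ler_wpM2r ?subr_ge0.
Qed.

Lemma soft_ramp_l c h t : 0 < h -> t <= c -> soft_ramp c h t = 0.
Proof.
by move=> h0 tc; rewrite /soft_ramp !ramp_l ?mulr0 ?addr0 ?mul0r//; lra.
Qed.

Lemma soft_ramp_r c h t : 0 < h -> c + 2 * h <= t -> soft_ramp c h t = t - c - h.
Proof.
by move=> h0 tc; rewrite /soft_ramp !ramp_r; [field; rewrite gt_eqF|lra..].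
Qed.

End SmoothedRamp.

(** * Functions of class H^2 *)

Section SecondDifference.
Context {R : realType}.
Variables (x y z : R).
Hypotheses (xy : x < y) (yz : y < z).

Definition slope_gap (f : R -> R) : R :=
  slope f y z - slope f x y.

(** Applied to the ramps with corners [x], [y] and [z], this is the hat function
    with vertices [x], [y], [z]; applied to the values [f x], [f y], [f z], it is
    [slope_gap f]. *)
Definition hat_combination (F : R -> R -> R) (t : R) : R :=
  (y - x)^-1 * (F x t + - 1 * F y t) + - (z - y)^-1 * (F y t + - 1 * F z t).

Lemma is_derive_hat (F G : R -> R -> R) t :
  (forall c, is_derive t (1 : R) (F c) (G c t)) ->
  is_derive t (1 : R) (hat_combination F) (hat_combination G t).
Proof.
move=> FG.
exact: (is_derive_add
  (is_derive_scale _ (is_derive_add (FG x) (is_derive_scale _ (FG y))))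
  (is_derive_scale _ (is_derive_add (FG y) (is_derive_scale _ (FG z))))).
Qed.

Lemma hat_combination_cts (F : R -> R -> R) :
  (forall c, continuous (F c)) -> continuous (hat_combination F).
Proof.
move=> cF t.
have c1 (k : R) : {for t, continuous (fun=> k)} by exact: cst_continuous.
have cf c : {for t, continuous (F c)} by exact: cF.
exact: (continuousD
  (continuousM (c1 _) (continuousD (cf x) (continuousM (c1 (- 1)) (cf y))))
  (continuousM (c1 _) (continuousD (cf y) (continuousM (c1 (- 1)) (cf z))))).
Qed.

Variables (a b h : R).
Hypotheses (ax : a < x) (zb : z + 2 * h < b) (h0 : 0 < h).

Let hat := hat_combination (fun c => soft_ramp c h).
Let hat' := hat_combination (fun c => soft_step c h).
Let hat'' := hat_combination (fun c => tent c h).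

Let dhat t : is_derive t (1 : R) hat (hat' t).
Proof. by apply: is_derive_hat => c; exact: is_derive_soft_ramp. Qed.

Let dhat' t : is_derive t (1 : R) hat' (hat'' t).
Proof. by apply: is_derive_hat => c; exact: is_derive_soft_step. Qed.

Let derive1_of (F G : R -> R) : (forall t, is_derive t (1 : R) F (G t)) -> derive1 F = G.
Proof. by move=> FG; apply/funext => t; rewrite derive1E; have [] := FG t. Qed.

Let right_of t : z + 2 * h < t ->
  [/\ z + 2 * h <= t, y + 2 * h <= t & x + 2 * h <= t].
Proof.
by move=> zt; have xy' := xy; have yz' := yz; split; lra.
Qed.

Lemma hat_out t : t \notin `[x, z + 2 * h] -> hat t = 0.
Proof.
have yx0 : y - x != 0 by rewrite subr_eq0 gt_eqF.
have zy0 : z - y != 0 by rewrite subr_eq0 gt_eqF.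
rewrite in_itv /= negb_and -!ltNge => /orP[tx|zt]; rewrite /hat /hat_combination.
  have ty := lt_trans tx xy; have tz := lt_trans ty yz.
  by rewrite !soft_ramp_l ?(ltW tx, ltW ty, ltW tz)//; ring.
have [zt' yt xt] := right_of zt.
by rewrite !soft_ramp_r//; field; rewrite ?yx0 ?zy0.
Qed.

Let hat'_out t : t \notin `[x, z + 2 * h] -> hat' t = 0.
Proof.
rewrite in_itv /= negb_and -!ltNge => /orP[tx|zt]; rewrite /hat' /hat_combination.
  have ty := lt_trans tx xy; have tz := lt_trans ty yz.
  by rewrite !soft_step_l ?(ltW tx, ltW ty, ltW tz)//; ring.
have [zt' yt xt] := right_of zt.
by rewrite !soft_step_r//; ring.
Qed.

Lemma hat_test : test_function a b hat.
Proof.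
split.
- by move=> t; have [] := dhat t.
- rewrite (derive1_of dhat); apply: hat_combination_cts => c t.
  by apply: differentiable_continuous; apply/derivable1_diffP; have [] := is_derive_soft_step c t h0.
- by exists x, (z + 2 * h); split => // t; exact: hat_out.
Qed.

Lemma hat'_test : test_function a b hat'.
Proof.
split.
- by move=> t; have [] := dhat' t.
- by rewrite (derive1_of dhat'); apply: hat_combination_cts => c; exact: tent_cts.
- by exists x, (z + 2 * h); split => // t; exact: hat'_out.
Qed.

(** The hat is a difference of two terms in [[0, 1]], because [soft_ramp] is
    nondecreasing and 1-Lipschitz. *)
Lemma hat_norm_le1 t : `|hat t| <= 1.
Proof.
have yx0 : 0 < y - x by rewrite subr_gt0.
have zy0 : 0 < z - y by rewrite subr_gt0.
(* soft_ramp c h is a translate of soft_ramp 0 h *)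
have tr c : soft_ramp c h t = soft_ramp 0 h (t - c).
  by rewrite /soft_ramp /ramp !add0r !subr0 !opprD !addrA.
have /andP[A0 A1] : 0 <= (y - x)^-1 * (soft_ramp x h t + - 1 * soft_ramp y h t) <= 1.
  rewrite mulN1r !tr.
  have /andP[] := @soft_ramp_increment _ 0 h (t - y) (t - x) h0 (lerB (lexx t) (ltW xy)).
  rewrite (_ : t - x - (t - y) = y - x); last by ring.
  move=> i0 i1.
  apply/andP; split; first by rewrite mulr_ge0// invr_ge0 ltW.
  by rewrite mulrC ler_pdivrMr// mul1r.
have /andP[B0 B1] : 0 <= (z - y)^-1 * (soft_ramp y h t + - 1 * soft_ramp z h t) <= 1.
  rewrite mulN1r !tr.
  have /andP[] := @soft_ramp_increment _ 0 h (t - z) (t - y) h0 (lerB (lexx t) (ltW yz)).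
  rewrite (_ : t - y - (t - z) = z - y); last by ring.
  move=> i0 i1.
  apply/andP; split; first by rewrite mulr_ge0// invr_ge0 ltW.
  by rewrite mulrC ler_pdivrMr// mul1r.
rewrite /hat /hat_combination mulNr ler_norml; apply/andP; split; lra.
Qed.

Lemma weak_second_derivative (f f1 f2 : R -> R) :
  weak_derivative a b f f1 -> weak_derivative a b f1 f2 ->
  (\int[@lebesgue_measure R]_(t in `]a, b[) (f t * hat'' t))%R =
  (\int[@lebesgue_measure R]_(t in `]a, b[) (f2 t * hat t))%R.
Proof.
move=> w1 w2.
have := w1 _ hat'_test; rewrite (derive1_of dhat') => ->.
by have := w2 _ hat_test; rewrite (derive1_of dhat) => ->; rewrite opprK.
Qed.

End SecondDifference.

Section TentAverages.
Context {R : realType}.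
Notation mu := (@lebesgue_measure R).
Implicit Types (a b x y z h e : R) (f g : R -> R).

Lemma continuous_integrable a b g : {within `[a, b], continuous g} ->
  mu.-integrable `[a, b] (EFin \o g).
Proof. by move=> cg; apply: continuous_compact_integrable => //; exact: segment_compact. Qed.

Lemma open_integrable a b g : {within `[a, b], continuous g} ->
  mu.-integrable `]a, b[ (EFin \o g).
Proof.
move=> cg; apply: (integrableS _ _ _ (continuous_integrable cg)) => //.
exact: subset_itv_oo_cc.
Qed.

Lemma Rintegral_oo_cc a b g : {within `[a, b], continuous g} ->
  (\int[mu]_(t in `]a, b[) g t = \int[mu]_(t in `[a, b]) g t)%R.
Proof.
move=> cg; rewrite Rintegral_itv_bndo_bndc; last exact: open_integrable.
rewrite Rintegral_itv_obnd_cbnd//.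
apply: (integrableS _ _ _ (continuous_integrable cg)) => //.
exact: subset_itv_oc_cc.
Qed.

Lemma tent_mass a b x h : a < b -> a <= x -> x + 2 * h <= b -> 0 < h ->
  (\int[mu]_(t in `[a, b]) tent x h t)%R = 1.
Proof.
move=> ab ax xb h0.
have cS t : continuous_at t (soft_step x h).
  by apply: differentiable_continuous; apply/derivable1_diffP; have [] := is_derive_soft_step x t h0.
rewrite /Rintegral (@continuous_FTC2 _ _ (soft_step x h)) //.
- by rewrite soft_step_r// soft_step_l//= subr0.
- by apply: continuous_subspaceT; exact: tent_cts.
- split; first by move=> t _; have [] := is_derive_soft_step x t h0.
  + by apply: cvg_at_right_filter; exact: cS.
  + by apply: cvg_at_left_filter; exact: cS.
- by move=> t _; rewrite derive1E; have [] := is_derive_soft_step x t h0.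
Qed.

Lemma within_continuous_tent a b f x h : {within `[a, b], continuous f} ->
  {within `[a, b], continuous (fun t => f t * tent x h t)}.
Proof.
move=> cf; apply: within_continuousM => //.
by apply: continuous_subspaceT; exact: tent_cts.
Qed.

Lemma tent_average a b f x h e : {within `[a, b], continuous f} ->
  a <= x -> x + 2 * h <= b -> 0 < h ->
  (forall t, t \in `[x, x + 2 * h] -> `|f t - f x| <= e) ->
  `|(\int[mu]_(t in `]a, b[) (f t * tent x h t))%R - f x| <= e.
Proof.
move=> cf ax xb h0 fe.
have ab : a < b by lra.
have cT : {within `[a, b], continuous (tent x h)}.
  by apply: continuous_subspaceT; exact: tent_cts.
rewrite Rintegral_oo_cc; last exact: within_continuous_tent.
have iT (c : R) : mu.-integrable `[a, b] (EFin \o (fun t => c * tent x h t)).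
  by apply: continuous_integrable; exact: within_continuous_scale.
have mass (c : R) : (\int[mu]_(t in `[a, b]) (c * tent x h t))%R = c.
  rewrite RintegralZl//; last exact: continuous_integrable.
  by rewrite tent_mass// mulr1.
have ifT : mu.-integrable `[a, b] (EFin \o (fun t => f t * tent x h t)).
  by apply: continuous_integrable; exact: within_continuous_tent.
rewrite -[X in _ - X](mass (f x)) -RintegralB//.
have cd : {within `[a, b], continuous (fun t => f t * tent x h t - f x * tent x h t)}.
  apply: within_continuousB; first exact: within_continuous_tent.
  exact: within_continuous_scale.
have id : mu.-integrable `[a, b] (EFin \o (fun t => f t * tent x h t - f x * tent x h t)).
  exact: continuous_integrable.
apply: (le_trans (le_normr_Rintegral _ id)) => //.
rewrite -[leRHS]mass; apply: le_Rintegral => //.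
  have := integrable_norm id; exact.
move=> t /= tab; rewrite -mulrBl normrM (ger0_norm (tent_ge0 x t h0)).
have [tx|xt] := leP t x; first by rewrite tent_out ?mulr0//; left.
have [tx|tx] := leP (x + 2 * h) t; first by rewrite tent_out ?mulr0//; right.
rewrite ler_wpM2r ?tent_ge0// fe// in_itv /= !ltW//.
Qed.

End TentAverages.

Section SlopeGap.
Context {R : realType}.
Notation mu := (@lebesgue_measure R).
Implicit Types (a b x y z h e : R) (f g : R -> R).

(** Young's inequality on the support of [phi]. *)
Lemma pairing_le a b x w e (g phi : R -> R) :
  a < x -> x <= w -> w < b -> 0 < e -> square_integrable a b g ->
  continuous phi -> (forall t, `|phi t| <= 1) ->
  (forall t, t \notin `[x, w] -> phi t = 0) ->
  `|(\int[mu]_(t in `]a, b[) (g t * phi t))%R| <=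
  e * (\int[mu]_(t in `]a, b[) (g t ^+ 2))%R + (w - x) / e.
Proof.
move=> ax xw wb e0 [mg ig] cphi phi1 phi0.
have sub : [set` `[x, w]] `<=` [set` `]a, b[].
  by move=> t /=; rewrite !in_itv /= => /andP[? ?]; rewrite (lt_le_trans ax)//= (le_lt_trans _ wb).
have -> : (\int[mu]_(t in `]a, b[) (g t * phi t))%R =
    (\int[mu]_(t in `[x, w]) (g t * phi t))%R.
  rewrite -[in RHS](setIidr sub) Rintegral_mkcondr.
  apply: eq_Rintegral => t _; rewrite patchE; case: ifPn => // tn.
  by rewrite phi0 ?mulr0//; apply: contra tn => tn; rewrite inE.
have i2 : mu.-integrable `[x, w] (EFin \o (fun t => g t ^+ 2)).
  by apply: (integrableS _ _ _ ig).
have i2e : mu.-integrable `[x, w] (EFin \o (fun t => e * g t ^+ 2)).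
  rewrite (_ : EFin \o _ = (fun t : R => (e%:E * (g t ^+ 2)%R%:E)%E)); last by apply/funext => t; rewrite /= EFinM.
  exact: integrableZl.
have ic : mu.-integrable `[x, w] (EFin \o cst e^-1).
  by apply: continuous_integrable; apply: continuous_subspaceT => t; exact: cst_continuous.
have iG : mu.-integrable `[x, w] (EFin \o (fun t => e * g t ^+ 2 + e^-1)).
  rewrite (_ : EFin \o _ = ((EFin \o (fun t : R => e * g t ^+ 2)%R) \+ (EFin \o cst e^-1%R))%E)//.
  exact: integrableD.
have dom t : `|g t * phi t| <= e * g t ^+ 2 + e^-1.
  rewrite normrM; apply: (le_trans (y := `|g t| * 1)); first by rewrite ler_wpM2l.
  have h := mul_self_ge0 (e * `|g t| - 1).
  have -> : e * g t ^+ 2 + e^-1 =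
      `|g t| * 1 + ((e * `|g t| - 1) * (e * `|g t| - 1) + e * `|g t|) / e.
    by rewrite -(real_normK (num_real (g t))); field; rewrite gt_eqF.
  rewrite lerDl; apply: divr_ge0; last exact: ltW.
  by apply: addr_ge0 => //; rewrite mulr_ge0// ltW.
have im : mu.-integrable `[x, w] (EFin \o (fun t => g t * phi t)).
  apply: (le_integrable _ _ _ iG) => //.
    apply/measurable_EFinP; apply: measurable_funM.
      by apply: measurable_funS mg.
    by apply: measurable_funTS; exact: continuous_measurable_fun.
  by move=> t _ /=; rewrite lee_fin (le_trans (dom t))// ler_norm.
apply: (le_trans (le_normr_Rintegral _ im)) => //.
apply: (le_trans (y := (\int[mu]_(t in `[x, w]) (e * g t ^+ 2 + e^-1))%R)).
  apply: le_Rintegral => //.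
  by have := integrable_norm im; exact.
rewrite RintegralD//; apply: lerD.
  rewrite RintegralZl//; rewrite ler_pM2l//.
  rewrite /Rintegral fine_le//.
  - exact: integrable_fin_num.
  - exact: integrable_fin_num.
  - apply: ge0_subset_integral => //.
      exact: (measurable_int mu ig).
    by move=> t _; rewrite lee_fin sqr_ge0.
have len : mu `[x, w] = (w - x)%:E.
  rewrite lebesgue_measure_itv /= lte_fin.
  by have [//|wx] := ltP x w; rewrite (le_anti (_ : x <= w <= x)) ?subrr ?xw.
by rewrite Rintegral_cst//= mulrC (_ : mu _ = (w - x)%:E).
Qed.

Lemma right_modulus a b f c e : {within `[a, b], continuous f} ->
  a < c -> c < b -> 0 < e ->
  exists2 r, 0 < r & forall t, t \in `[c, c + r] -> `|f t - f c| <= e.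
Proof.
move=> cf ac cb e0.
have ab : a < b by exact: lt_trans cb.
have cfc : {for c, continuous f}.
  have := cf; rewrite continuous_within_itvP// => -[h _ _].
  by apply: h; rewrite in_itv /= ac.
have /cvgrPdist_le/(_ e e0) := cfc.
move=> /nbhs_ballP[r /= r0 hr]; exists (r / 2); first by rewrite divr_gt0.
move=> t; rewrite in_itv /= => /andP[ct tc]; rewrite distrC.
apply: hr; rewrite /ball /= ltr_norml; apply/andP; split; lra.
Qed.

Lemma Rintegral_hat_combination a b x y z (F : R -> R -> R) :
  (forall c, {within `[a, b], continuous (F c)}) ->
  (\int[mu]_(t in `]a, b[) hat_combination x y z F t)%R =
  hat_combination x y z (fun c _ => (\int[mu]_(t in `]a, b[) F c t)%R) 0.
Proof.
move=> cF; have iF (k : R) c : mu.-integrable `]a, b[ (EFin \o (fun t => k * F c t)).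
  by apply: open_integrable; exact: within_continuous_scale.
have iF1 c : mu.-integrable `]a, b[ (EFin \o F c) by exact: open_integrable.
have cFF c d : {within `[a, b], continuous (fun t => F c t + - 1 * F d t)}.
  by apply: within_continuous_add => //; exact: within_continuous_scale.
rewrite /hat_combination RintegralD//; last 2 first.
- by apply: open_integrable; exact: within_continuous_scale.
- by apply: open_integrable; exact: within_continuous_scale.
rewrite !RintegralZl//; try exact: open_integrable.
by rewrite !RintegralD// !RintegralZl.
Qed.

(** Pairing [f] with the second derivative of a smoothed hat gives averages of
    [f] near [x], [y] and [z], which tend to the values of [f] as [h] decreases to
    0; integrating by parts twice gives the pairing of the second derivative
    of [f] with the hat, bounded by [pairing_le].  The free parameter [e] makes
    the bound small when [z - x] is. *)
Lemma H2_slope_gap a b f : H2 a b f ->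
  exists2 N, 0 <= N & forall x y z e, a < x -> x < y -> y < z -> z < b -> 0 < e ->
    `|slope_gap x y z f| <= e * N + 2 * (z - x) / e.
Proof.
move=> [cf [f1 [f2 [_ _ sf2 w1 w2]]]].
exists ((\int[mu]_(t in `]a, b[) (f2 t ^+ 2))%R + 1).
  by rewrite addr_ge0//; apply: Rintegral_ge0 => t _; exact: sqr_ge0.
move=> x y z e ax xy yz zb e0.
have yx0 : 0 < (y - x)^-1 by rewrite invr_gt0 subr_gt0.
have zy0 : 0 < (z - y)^-1 by rewrite invr_gt0 subr_gt0.
pose eta := e / (2 * (y - x)^-1 + 2 * (z - y)^-1).
have eta0 : 0 < eta by rewrite divr_gt0// addr_gt0 ?mulr_gt0.
have [rx rx0 hx] := right_modulus cf ax (lt_trans xy (lt_trans yz zb)) eta0.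
have [ry ry0 hy] := right_modulus cf (lt_trans ax xy) (lt_trans yz zb) eta0.
have [rz rz0 hz] := right_modulus cf (lt_trans ax (lt_trans xy yz)) zb eta0.
pose m := Num.min (Num.min rx ry) (Num.min rz (Num.min (b - z) (z - x))).
have m0 : 0 < m by rewrite !lt_min rx0 ry0 rz0 !subr_gt0 zb (lt_trans xy).
(* [h] is so small that the supports of the tents stay in the interval and the
   oscillation of [f] on them is at most [eta]. *)
pose h := m / 4.
have h0 : 0 < h by rewrite divr_gt0.
have hm : 2 * h < m by rewrite /h; lra.
have [mx [my [mz [mb mzx]]]] : m <= rx /\ m <= ry /\ m <= rz /\ m <= b - z /\ m <= z - x.
  by rewrite /m !ge_min !lexx ?orbT; do !split.
have xh : z + 2 * h < b by lra.
have av c : c \in [:: x; y; z] ->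
    `|(\int[mu]_(t in `]a, b[) (f t * tent c h t))%R - f c| <= eta.
  have sub (r t : R) : m <= r -> t \in `[c, c + 2 * h] -> t \in `[c, c + r].
    by rewrite !in_itv /= => mr /andP[-> ?] /=; lra.
  rewrite !inE => /or3P[]/eqP ec; subst c; apply: tent_average => //;
    try lra; move=> t tc; [apply: hx|apply: hy|apply: hz]; exact: sub tc.
have e1 := weak_second_derivative xy yz ax xh h0 w1 w2.
have e2 : (\int[mu]_(t in `]a, b[) (f t * hat_combination x y z (fun c => tent c h) t))%R =
    hat_combination x y z (fun c _ => (\int[mu]_(t in `]a, b[) (f t * tent c h t))%R) 0.
  rewrite -(@Rintegral_hat_combination a b x y z (fun c t => f t * tent c h t)); last first.
    by move=> c; exact: within_continuous_tent.
  by apply: eq_Rintegral => t _; rewrite /hat_combination; ring.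
set I := fun c => (\int[mu]_(t in `]a, b[) (f t * tent c h t))%R in e2 av.
have J : `|hat_combination x y z (fun c _ => I c) 0| <=
   e * (\int[mu]_(t in `]a, b[) (f2 t ^+ 2))%R + (z + 2 * h - x) / e.
  rewrite -e2 e1; apply: pairing_le => //.
  - by lra.
  - by apply: hat_combination_cts => c t; apply: differentiable_continuous;
      apply/derivable1_diffP; have [] := is_derive_soft_ramp c t h0.
  - by move=> t; apply: hat_norm_le1.
  - by move=> t; apply: hat_out.
have gapE : slope_gap x y z f = hat_combination x y z (fun c _ => I c) 0
   + hat_combination x y z (fun c _ => f c - I c) 0.
  by rewrite /slope_gap /slope /hat_combination; ring.
have small : `|hat_combination x y z (fun c _ => f c - I c) 0| <= e.
  have avd c : c \in [:: x; y; z] -> `|f c - I c| <= eta by move=> /av; rewrite distrC.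
  have two (k u v : R) : 0 < k -> `|u| <= eta -> `|v| <= eta -> `|k * (u + - 1 * v)| <= k * (2 * eta).
    move=> k0 hu hv; rewrite normrM (gtr0_norm k0) ler_pM2l// mulN1r.
    by rewrite (le_trans (ler_normB _ _))//; lra.
  have -> : e = (y - x)^-1 * (2 * eta) + (z - y)^-1 * (2 * eta).
    rewrite /eta; set A := (y - x)^-1 in yx0 *; set B := (z - y)^-1 in zy0 *.
    by field; rewrite gt_eqF// addr_gt0// mulr_gt0.
  rewrite /hat_combination (le_trans (ler_normD _ _))// lerD//.
    by apply: two => //; apply: avd; rewrite !inE eqxx ?orbT.
  by rewrite (mulNr (z - y)^-1) normrN; apply: two => //; apply: avd; rewrite !inE eqxx ?orbT.
rewrite gapE (le_trans (ler_normD _ _))// (le_trans (lerD J small))//.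
have len : (z + 2 * h - x) / e <= 2 * (z - x) / e by rewrite ler_pM2r ?invr_gt0//; lra.
by rewrite [X in _ <= X + _]mulrDr mulr1 addrAC lerD.
Qed.

End SlopeGap.

Section SobolevDerivative.
Context {R : realType}.
Implicit Types (a b c x y z r e : R) (f : R -> R).

Lemma slopeC f x y : slope f x y = slope f y x.
Proof. by rewrite /slope -[y - x]opprB -[f y - f x]opprB invrN mulrNN. Qed.

Lemma derivable_of_cauchy_slopes f c :
  (forall e, 0 < e -> exists2 r, 0 < r & forall y z, y != c -> z != c ->
    `|y - c| < r -> `|z - c| < r -> `|slope f c y - slope f c z| <= e) ->
  exists g, is_derive c (1 : R) f g.
Proof.
move=> H.
have cs : cvg (slope f c @ c^').
  apply/cauchy_cvgP; apply: cauchy_exP => e e0.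
  have [r r0 hr] := H (e / 2) (divr_gt0 e0 (ltr0Sn _ _)).
  exists (slope f c (c + r / 2)).
  have near_c : \forall y \near c^', y != c /\ `|y - c| < r.
    rewrite near_withinE; apply/nbhs_ballP; exists r => // y.
    by rewrite /ball /= distrC => yr yc.
  move: near_c; apply: filterS => y [yc yr].
  rewrite /ball /=; apply: (le_lt_trans (hr _ _ _ yc _ yr)).
  - by rewrite gt_eqF// ltrDl divr_gt0.
  - by rewrite addrAC subrr add0r gtr0_norm ?divr_gt0//; lra.
  - by lra.
have [g hg] := (cvg_ex _).1 cs.
exists g; apply: is_derive_of_slopes => e e0.
move/cvgrPdist_le : hg => /(_ e e0).
rewrite near_withinE => /nbhs_ballP[r /= r0 hr]; exists r => // y yc yr.
by apply: hr => //; rewrite /ball /= distrC.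
Qed.

Lemma slope_near_derivative f c g e : is_derive c (1 : R) f g -> 0 < e ->
  exists2 r, 0 < r & forall y, y != c -> `|y - c| < r -> `|g - slope f c y| <= e.
Proof.
move=> [df <-] e0; have := df; rewrite /derivable => /cvgrPdist_le/(_ e e0).
rewrite near_withinE => /nbhs_ballP[r /= r0 hr]; exists r => // y yc yr.
have := hr (y - c); rewrite /ball /= sub0r normrN => /(_ yr).
rewrite subr_eq0 => /(_ yc); rewrite /derive /slope.
by rewrite [(y - c) *: 1]mulr1 subrK mulrC.
Qed.

(** Slopes on opposite sides of [c] are compared by [H2_slope_gap]; two slopes on
    the same side are compared through one on the other side. *)
Lemma H2_derivable a b f : H2 a b f ->
  forall c, c \in `]a, b[ -> exists g, is_derive c (1 : R) f g.
Proof.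
move=> /H2_slope_gap[N N0 gap] c; rewrite in_itv /= => /andP[ac cb].
apply: derivable_of_cauchy_slopes => eta eta0.
pose e := eta / (4 * (N + 1)).
have N1 : 0 < 4 * (N + 1) by rewrite mulr_gt0// ltr_wpDl.
have e0 : 0 < e by rewrite divr_gt0.
pose r := Num.min (e * eta / 16) (Num.min (c - a) (b - c)).
have r0 : 0 < r by rewrite !lt_min !subr_gt0 ac cb !andbT divr_gt0// mulr_gt0.
have [re [ra rb]] : r <= e * eta / 16 /\ r <= c - a /\ r <= b - c.
  by rewrite /r !ge_min !lexx ?orbT; do !split.
have eN : e * N <= eta / 4.
  have -> : eta / 4 = e * N + e by rewrite /e; field; rewrite gt_eqF// ltr_wpDl.
  by rewrite lerDl ltW.
have opp y z : c - r < y -> y < c -> c < z -> z < c + r ->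
    `|slope f c z - slope f c y| <= eta / 2.
  move=> ry yc cz zr; rewrite (slopeC f c y).
  have ay : a < y by lra.
  have zb : z < b by lra.
  have := gap y c z e ay yc cz zb e0.
  move=> /le_trans; apply.
  have : 2 * (z - y) / e <= eta / 4.
    rewrite ler_pdivrMr//; have : z - y <= 2 * r by lra.
    by have := re; rewrite (mulrC e); lra.
  by lra.
exists r => // y z yc zc; rewrite !ltr_distl => /andP[y1 y2] /andP[z1 z2].
have lo : c - r < c - r / 2 /\ c - r / 2 < c by split; lra.
have hi : c < c + r / 2 /\ c + r / 2 < c + r by split; lra.
have [[lo1 lo2] [hi1 hi2]] := (lo, hi).
move: yc zc; rewrite !neq_lt => /orP[yc|yc] /orP[zc|zc].
- have h1 := opp y _ y1 yc hi1 hi2; have h2 := opp z _ z1 zc hi1 hi2.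
  rewrite distrC in h1.
  have -> : slope f c y - slope f c z = (slope f c y - slope f c (c + r / 2))
    + (slope f c (c + r / 2) - slope f c z) by rewrite addrA subrK.
  by rewrite (le_trans (ler_normD _ _))//; lra.
- by have := opp y z y1 yc zc z2; rewrite distrC; lra.
- by have := opp z y z1 zc yc y2; lra.
- have h1 := opp _ y lo1 lo2 yc y2; have h2 := opp _ z lo1 lo2 zc z2.
  rewrite distrC in h2.
  have -> : slope f c y - slope f c z = (slope f c y - slope f c (c - r / 2))
    + (slope f c (c - r / 2) - slope f c z) by rewrite addrA subrK.
  by rewrite (le_trans (ler_normD _ _))//; lra.
Qed.

(** Successive slopes differ by a bounded amount, so the slope near any point is
    compared in at most two steps with the slope of one of two fixed chords, on
    the side of the midpoint away from that point. *)
Lemma H2_bounded_derivative a b f : a < b -> H2 a b f ->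
  exists d : R -> R, exists L : R, forall c, c \in `]a, b[ ->
    is_derive c 1 f (d c) /\ `|d c| <= L.
Proof.
move=> ab hf.
have dex c : exists g : R, c \in `]a, b[ -> is_derive c 1 f g.
  have [cab|nc] := boolP (c \in `]a, b[); last by exists 0.
  by have [g] := H2_derivable hf cab; exists g.
have [d hd] := choice dex.
have [N N0 gap] := H2_slope_gap hf.
pose p i := a + i * (b - a) / 4.
pose G := N + 2 * (b - a).
have gapG x y z : a < x -> x < y -> y < z -> z < b ->
    `|slope f y z - slope f x y| <= G.
  move=> ax xy yz zb; have := gap x y z 1 ax xy yz zb ltr01.
  rewrite /slope_gap mul1r divr1 => /le_trans; apply.
  by rewrite /G; lra.
have [p1a p12 p23 p3b] : [/\ a < p 1, p 1 < p 2, p 2 < p 3 & p 3 < b].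
  by rewrite /p; split; lra.
have G0 : 0 <= G by rewrite /G; lra.
exists d, (`|slope f (p 1) (p 2)| + `|slope f (p 2) (p 3)| + 2 * G + 1) => c cab.
split; first exact: hd.
have [r r0 hr] := slope_near_derivative (hd c cab) ltr01.
move: cab; rewrite in_itv /= => /andP[ac cb].
suff [y [yc yr ys]] : exists y, [/\ y != c, `|y - c| < r &
    `|slope f c y| <= `|slope f (p 1) (p 2)| + `|slope f (p 2) (p 3)| + 2 * G].
  have := hr y yc yr; move: ys; rewrite !ler_norml => /andP[? ?] /andP[? ?].
  by apply/andP; split; lra.
have n1 := normr_ge0 (slope f (p 1) (p 2)); have n2 := normr_ge0 (slope f (p 2) (p 3)).
pose m := Num.min r (Num.min (c - a) (b - c)).
have m0 : 0 < m by rewrite !lt_min r0 !subr_gt0 ac cb.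
have [mr [ma mb]] : m <= r /\ m <= c - a /\ m <= b - c.
  by rewrite /m !ge_min !lexx ?orbT; do !split.
have step (u v w B : R) : `|u - v| <= G -> `|v| <= B -> B + G <= w -> `|u| <= w.
  move=> h1 h2 h3; have -> : u = (u - v) + v by rewrite subrK.
  by rewrite (le_trans (ler_normD _ _))//; lra.
have [p2c|cp2] := leP (p 2) c.
  exists (c + m / 2); split.
  - by rewrite gt_eqF// ltrDl divr_gt0.
  - by rewrite addrAC subrr add0r gtr0_norm ?divr_gt0//; lra.
  have cy : c < c + m / 2 by lra.
  have yb : c + m / 2 < b by lra.
  move: p2c; rewrite le_eqVlt => /predU1P[p2c|p2c].
    subst c.
    by apply: (step _ _ _ _ (gapG _ _ _ p1a p12 cy yb) (lexx _)); lra.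
  apply: (step _ _ _ _ (gapG _ _ _ _ p2c cy yb)).
  - exact: lt_trans p12.
  - by apply: (step _ _ _ _ (gapG _ _ _ p1a p12 p2c cb) (lexx _) (lexx _)).
  - by lra.
exists (c - m / 2); split.
- by rewrite lt_eqF// ltrBlDr ltrDl divr_gt0.
- by rewrite addrAC subrr add0r normrN gtr0_norm ?divr_gt0//; lra.
have yc : c - m / 2 < c by lra.
have ay : a < c - m / 2 by lra.
have p2b : p 2 < b by exact: lt_trans p3b.
rewrite slopeC; have h1 := gapG _ _ _ ay yc cp2 p2b; rewrite distrC in h1.
have h2 := gapG _ _ _ ac cp2 p23 p3b; rewrite distrC in h2.
apply: (step _ _ _ _ h1 (step _ _ _ _ h2 (lexx _) (lexx _))).
by lra.
Qed.

End SobolevDerivative.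

(** * From eigenvalues to normalised modes *)

Section Assembly.
Context {R : realType}.

Lemma continuous_bounded_above (a b : R) (f : R -> R) : a < b ->
  {within `[a, b], continuous f} ->
  exists B, forall x, x \in `[a, b] -> f x <= B.
Proof. by move=> ab /(EVT_max (ltW ab))[c _ fc]; exists (f c). Qed.

Lemma coefficients_boundedW (a b : R) (sigma q rho : R -> R) K K' : K <= K' ->
  coefficients_bounded a b sigma q rho K ->
  coefficients_bounded a b sigma q rho K'.
Proof.
move=> KK [K0 crs [d hd] bd]; split => //; first exact: lt_le_trans KK.
  by exists d => x /hd[? /le_trans dK]; split => //; exact: dK.
move=> x /bd[/andP[s0 sK] /andP[r0 rK] rsK /andP[q0 qK]].
split; first by rewrite s0 (le_trans sK).
- by rewrite r0 (le_trans rK).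
- by apply: (le_trans rsK); rewrite ler_wpM2r// mulr_ge0// ltW.
- by rewrite q0 (le_trans qK).
Qed.

Lemma H2_coefficients_bounded (a b : R) (sigma q rho : R -> R) : a < b ->
  H2 a b rho -> H2 a b sigma -> {within `[a, b], continuous q} ->
  uniformly_positive a b rho -> uniformly_positive a b sigma ->
  uniformly_positive a b q -> exists K, coefficients_bounded a b sigma q rho K.
Proof.
move=> ab hr hs cq [cr cr0 rpos] [cs cs0 spos] [cq' cq0 qpos].
have [dr [Lr hdr]] := H2_bounded_derivative ab hr.
have [ds [Ls hds]] := H2_bounded_derivative ab hs.
case: (hr) (hs) => [ctr _] [cts _].
have [Br hBr] := continuous_bounded_above ab ctr.
have [Bs hBs] := continuous_bounded_above ab cts.
have [Bq hBq] := continuous_bounded_above ab cq.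
have aab : a \in `[a, b] by rewrite in_itv /= lexx ltW.
have pos (f : R -> R) (c B : R) : 0 < c -> (forall x, x \in `[a, b] -> c <= f x) ->
    (forall x, x \in `[a, b] -> f x <= B) -> 0 < B.
  by move=> c0 cf fB; apply: (lt_le_trans c0); apply: le_trans (cf a aab) (fB a aab).
have Br0 := pos _ _ _ cr0 rpos hBr; have Bs0 := pos _ _ _ cs0 spos hBs.
have Bq0 := pos _ _ _ cq0 qpos hBq.
have mab : (a + b) / 2 \in `]a, b[ by rewrite in_itv /=; apply/andP; split; lra.
have Lr0 : 0 <= Lr by have [_] := hdr _ mab; exact: le_trans.
have Ls0 : 0 <= Ls by have [_] := hds _ mab; exact: le_trans.
have inv0 : 0 < (cr * cs)^-1 by rewrite invr_gt0 mulr_gt0.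
have D0 : 0 <= Br * Ls + Bs * Lr by rewrite addr_ge0// mulr_ge0// ltW.
exists (Br + Bs + Bq + (cr * cs)^-1 + (Br * Ls + Bs * Lr)); split.
- by lra.
- exact: within_continuousM.
- exists (fun x => rho x * ds x + sigma x * dr x) => x xab.
  have [drx Lrx] := hdr x xab; have [dsx Lsx] := hds x xab.
  have xab' : x \in `[a, b] by exact: subset_itv_oo_cc xab.
  split; first exact: is_derive_mul.
  apply: (le_trans (ler_normD _ _)); rewrite !normrM.
  have r0 : 0 < rho x by exact: lt_le_trans (rpos x xab').
  have s0 : 0 < sigma x by exact: lt_le_trans (spos x xab').
  rewrite (gtr0_norm r0) (gtr0_norm s0).
  have h1 : rho x * `|ds x| <= Br * Ls by rewrite ler_pM ?hBr// ltW.
  have h2 : sigma x * `|dr x| <= Bs * Lr by rewrite ler_pM ?hBs// ltW.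
  by lra.
- move=> x xab.
  have r1 := rpos x xab; have r2 := hBr x xab.
  have s1 := spos x xab; have s2 := hBs x xab.
  have q1 := qpos x xab; have q2 := hBq x xab.
  split; try by apply/andP; split; lra.
  apply: (le_trans (y := (cr * cs)^-1 * (rho x * sigma x))).
    rewrite mulrC ler_pdivlMr ?mulr_gt0// mul1r.
    by rewrite ler_pM// ltW.
  rewrite ler_wpM2r//; last by lra.
  by rewrite mulr_ge0// ltW// (lt_le_trans _ r1, lt_le_trans _ s1).
Qed.

Lemma sturm_liouville_flow (a b : R) (sigma q rho : R -> R) K lam (u u' : R -> R) :
  coefficients_bounded a b sigma q rho K -> {within `[a, b], continuous sigma} ->
  C1_on a b u u' -> sturm_liouville a b sigma q rho lam u u' ->
  flow a b sigma q rho lam u (fun x => sigma x * u' x) (fun=> 0).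
Proof.
move=> [_ _ _ bd] cs [cu cu' du] sl; split => //.
- exact: within_continuousM.
- move=> x xab; apply: is_derive_eq (du x xab) _.
  have /bd[/andP[s0 _] _ _ _] : x \in `[a, b] by exact: subset_itv_oo_cc xab.
  by rewrite mulrAC divff ?mul1r// gt_eqF.
- move=> x xab; have [dp e] := sl x xab.
  apply: DeriveDef => //; rewrite -derive1E.
  have -> : (q x - lam * rho x) * u x + 0 = q x * u x - lam * rho x * u x by ring.
  by rewrite -e; ring.
Qed.

Variables (M K lam0 : R) (sigma1 q1 rho1 sigma2 q2 rho2 : R -> R).
Hypothesis cb1 : coefficients_bounded (- 1) 0 sigma1 q1 rho1 K.
Hypothesis cb2 : coefficients_bounded 0 1 sigma2 q2 rho2 K.
Hypothesis cs1 : {within `[-1, 0], continuous sigma1}.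
Hypothesis cs2 : {within `[0, 1], continuous sigma2}.
Hypothesis lam0_gt0 : 0 < lam0.

(** Uniqueness for the Cauchy problem at the Dirichlet endpoint: this makes the
    normalisation by the endpoint fluxes possible. *)
Lemma flow_trivial (a b : R) (sigma q rho : R -> R) e lam (u p : R -> R) :
  coefficients_bounded a b sigma q rho K -> b = a + 1 -> lam0 <= lam ->
  flow a b sigma q rho lam u p (fun=> 0) -> e \in `[a, b] -> u e = 0 ->
  p e = 0 -> forall x, x \in `[a, b] -> u x = 0.
Proof.
move=> cb ab l0 fu eab ue pe x xab.
have := position_upper cb ab lam0_gt0 l0 fu eab ue xab.
rewrite pe !mulr0 pmulr_rle0; last exact: lt_le_trans l0.
rewrite -expr2 => h; apply/eqP; rewrite -sqrf_eq0.
by rewrite eq_le h sqr_ge0.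
Qed.

Lemma eigenvalue_normalized_mode lam : lam0 <= lam ->
  is_eigenvalue M rho1 sigma1 q1 rho2 sigma2 q2 lam ->
  exists u p v w, normalized_mode M sigma1 q1 rho1 sigma2 q2 rho2 lam u p v w.
Proof.
move=> l0 [u [u' [v [v' [[[cu cv] slu slv [u1 v1 uv] j] nz]]]]].
have fu := sturm_liouville_flow cb1 cs1 cu slu.
have fv := sturm_liouville_flow cb2 cs2 cv slv.
set p := fun x => sigma1 x * u' x in fu; set w := fun x => sigma2 x * v' x in fv.
have m10 : (- 1 : R) \in `[(- 1 : R), 0] by rewrite in_itv /= lexx lerN10.
have p01 : (1 : R) \in `[(0 : R), 1] by rewrite in_itv /= lexx ler01.
set n := p (- 1) * p (- 1) + w 1 * w 1.
have n0 : 0 < n.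
  rewrite lt_def addr_ge0 ?mul_self_ge0// andbT; apply/negP.
  have self0 (y : R) : y * y == 0 -> y = 0 by rewrite mulf_eq0 orbb => /eqP.
  rewrite paddr_eq0 ?mul_self_ge0// => /andP[/self0 p0 /self0 w0].
  case: nz => [[x xab]|[x xab]]; apply/negP; rewrite negbK; apply/eqP.
    by apply: (flow_trivial cb1 _ l0 fu m10 u1 p0 xab); rewrite addNr.
  by apply: (flow_trivial cb2 _ l0 fv p01 v1 w0 xab); rewrite add0r.
pose c := (Num.sqrt n)^-1.
exists (fun x => c * u x), (fun x => c * p x), (fun x => c * v x), (fun x => c * w x).
split; try exact: flow_scale.
- by rewrite u1 v1 uv !mulr0.
- by rewrite -mulrBr j; ring.
- have -> : c * p (-1) * (c * p (-1)) + c * w 1 * (c * w 1) = c ^+ 2 * n.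
    by rewrite /n; ring.
  by rewrite /c exprVn sqr_sqrtr ?ltW// mulVf// gt_eqF.
Qed.

End Assembly.

Unset Implicit Arguments.

(* lambda n is the eigenvalue usually written lambda_(n+1). *)
Theorem theorem3p1 (R : realType) (M : R)
    (rho1 sigma1 q1 rho2 sigma2 q2 : R -> R) (lambda : nat -> R) :
  0 < M ->
  H2 (-1) 0 rho1 -> H2 (-1) 0 sigma1 -> {within `[-1, 0], continuous q1} ->
  H2 0 1 rho2 -> H2 0 1 sigma2 -> {within `[0, 1], continuous q2} ->
  uniformly_positive (-1) 0 rho1 -> uniformly_positive (-1) 0 sigma1 ->
  uniformly_positive (-1) 0 q1 ->
  uniformly_positive 0 1 rho2 -> uniformly_positive 0 1 sigma2 ->
  uniformly_positive 0 1 q2 ->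
  0 < lambda 0%N ->
  (forall n, lambda n < lambda n.+1) ->
  range lambda = is_eigenvalue M rho1 sigma1 q1 rho2 sigma2 q2 ->
  exists2 delta1 : R, 0 < delta1 &
    forall n, delta1 <= lambda n.+1 - lambda n.
Proof.
move=> M0 hr1 hs1 cq1 hr2 hs2 cq2 pr1 ps1 pq1 pr2 ps2 pq2 l0 incr rg.
have [K1 b1] := H2_coefficients_bounded (ltrN10 R) hr1 hs1 cq1 pr1 ps1 pq1.
have [K2 b2] := H2_coefficients_bounded (ltr01 : 0 < 1 :> R) hr2 hs2 cq2 pr2 ps2 pq2.
pose K := Num.max K1 K2.
have {}b1 : coefficients_bounded (-1) 0 sigma1 q1 rho1 K.
  by apply: coefficients_boundedW b1; rewrite le_max lexx.
have {}b2 : coefficients_bounded 0 1 sigma2 q2 rho2 K.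
  by apply: coefficients_boundedW b2; rewrite le_max lexx orbT.
have [delta d0 gap] := normalized_modes_gap b1 b2 M0 l0.
have ge0 n : lambda 0%N <= lambda n.
  by elim: n => // n /le_trans; apply; exact/ltW.
have mode n : exists u p v w,
    normalized_mode M sigma1 q1 rho1 sigma2 q2 rho2 (lambda n) u p v w.
  apply: (eigenvalue_normalized_mode b1 b2 hs1.1 hs2.1 l0 (ge0 n)).
  by rewrite -rg; exists n.
exists delta => // n.
have [u [p [v [w md]]]] := mode n; have [U [P [V [Q mD]]]] := mode n.+1.
exact: gap (ge0 n) (incr n) md mD.
Qed.
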